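(* Let $(S,P)$ be a pair of commuting operators on a Hilbert space. Then $(S,P)$ is a $\Gamma$-unitary if and only if $P$ is a normal operator, $S=S^*P$ and $$\sqrt{(S^2-4P)^*(S^2-4P)}+S^*S=4I.$$
   Context: All operators are bounded linear operators on complex Hilbert spaces. For a positive operator $Q$, $\sqrt Q$ denotes its unique positive square root. The closed symmetrized bidisc is $\Gamma=\{(z_1+z_2,\,z_1z_2) : z_1,z_2\in\mathbb C,\ |z_1|\leq 1,\ |z_2|\leq 1\}\subset\mathbb C^2$, and $b\Gamma$ denotes its distinguished boundary (the Shilov boundary of $\Gamma$ with respect to the algebra of functions continuous on $\Gamma$ and holomorphic in its interior); it is known that $b\Gamma=\{(z_1+z_2,\,z_1z_2): |z_1|=|z_2|=1\}=\{(s,p)\in\Gamma : |p|=1\}$. A commuting pair of operators $(S,P)$ on a Hilbert space is a $\Gamma$-unitary if $S$ and $P$ are normal operators and the Taylor joint spectrum $\sigma_T(S,P)$ is a subset of $b\Gamma$. *)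

(* Defs.v *)
From HB Require Import structures.
From mathcomp Require Import all_boot all_order all_algebra.
From mathcomp Require Import all_classical all_reals all_analysis.
From mathcomp Require Import sesquilinear complex.

Set Implicit Arguments.
Unset Strict Implicit.
Unset Printing Implicit Defensive.

Import Order.TTheory GRing.Theory Num.Theory.
Import numFieldNormedType.Exports.

Local Open Scope classical_set_scope.
Local Open Scope ring_scope.
Local Open Scope complex_scope.

(* The scalar field is R[i] for R : realType; as in every normed module over
   R[i], norms take (nonnegative real) values in R[i].  The inner product is
   linear in its first argument. *)
Record hilbertSpace (R : realType) := HilbertSpace {
  hilbert_sort :> completeNormedModType R[i];
  inner : {dot hilbert_sort for Num.conj};
  inner_norm : forall x : hilbert_sort, `|x| ^+ 2 = inner x x }.

Section Operators.
Context {R : realType} {H : hilbertSpace R}.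
Implicit Types S P Q T A B : H -> H.

Definition bounded_operator T : Prop :=
  linear T /\ exists M : R, forall x, `|T x| <= M%:C * `|x|.

(* By the Riesz representation theorem every bounded operator T has exactly one
   map satisfying the condition below; the default 0 is used only if T has no
   adjoint. *)
Definition adjoint T : H -> H :=
  xget 0 [set T' : H -> H | forall x y, inner H (T x) y = inner H x (T' y)].

Definition normal_operator T : Prop := T \o adjoint T = adjoint T \o T.

(* 0 <= z in R[i] means that z is real and nonnegative. *)
Definition positive_operator T : Prop :=
  bounded_operator T /\ forall x, 0 <= inner H (T x) x.

(* The unique positive square root of a positive operator Q; the default 0 is
   used only if Q is not positive. *)
Definition sqrt_operator Q : H -> H :=
  xget 0 [set T : H -> H | positive_operator T /\ T \o T = Q].

(* Koszul complex 0 -> H -> H * H -> H -> 0 of a commuting pair (A, B). *)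
Definition koszul0 A B (x : H) : H * H := (A x, B x).
Definition koszul1 A B (w : H * H) : H := A w.2 - B w.1.

Definition koszul_exact A B : Prop :=
  [/\ koszul0 A B @^-1` [set 0] = [set 0],
      koszul1 A B @^-1` [set 0] = range (koszul0 A B) &
      range (koszul1 A B) = setT].

Definition taylor_spectrum S P : set (R[i]^o * R[i]^o) :=
  [set l | ~ koszul_exact (S - l.1 *: idfun) (P - l.2 *: idfun)].

End Operators.

Section SymmetrizedBidisc.
Context {R : realType}.
Local Notation C := (R[i]^o).

Definition Gamma : set (C * C) :=
  [set (z.1 + z.2, z.1 * z.2) | z in [set z : C * C | `|z.1| <= 1 /\ `|z.2| <= 1]].

(* Differentiability is over the field R[i], i.e. complex differentiability. *)
Definition disc_algebra (K : set (C * C)) : set (C * C -> C) :=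
  [set f | {within K, continuous f} /\ forall w, K° w -> differentiable f w].

(* For compact K and f continuous on K, this says that |f| attains its maximum
   over K at some point of F. *)
Definition closed_boundary (K : set (C * C)) (F : set (C * C)) : Prop :=
  [/\ closed F, F `<=` K &
      forall f, disc_algebra K f ->
        exists2 w, F w & forall z, K z -> `|f z| <= `|f w|].

(* The smallest closed boundary, expressed as the intersection of all of them. *)
Definition shilov_boundary (K : set (C * C)) : set (C * C) :=
  \bigcap_(F in closed_boundary K) F.

Definition bGamma : set (C * C) := shilov_boundary Gamma.

End SymmetrizedBidisc.

Definition Gamma_unitary {R : realType} {H : hilbertSpace R} (S P : H -> H) :=
  [/\ S \o P = P \o S, normal_operator S, normal_operator P &
      taylor_spectrum S P `<=` bGamma].

(* Main.v *)
(* Joint approximate eigenvalues of commuting normal operators replace the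
   spectral theorem.  If A is selfadjoint and preserves the directions where a
   seminorm b nearly vanishes, then, r being the largest norm of A on these
   directions, r or -r is an approximate eigenvalue of A on them.  Iterating this
   over real and imaginary parts extends an approximate eigenvalue of a
   selfadjoint operator of the form P*P - 1, (S - S*P)*(S - S*P) or S*S to a joint
   one (s, p) of (S, P), which lies in the Taylor spectrum because a surjective
   Koszul map (u, v) |-> (S - s)u - (P - p)v cannot have a dual that is not
   bounded below.  On the distinguished boundary |p| = 1, s = conj(s) p and
   |s| <= 2, whence P*P = 1, S = S*P and S*S <= 4; then
   (S^2 - 4P)*(S^2 - 4P) = (4 - S*S)^2, and positive square roots are unique.
   Fuglede's theorem is avoided: S* preserves the approximate eigenspaces of P,
   which are those of P*, and once P is unitary it commutes with S*.
   Conversely, PP* = P*P and S = S*P give SP* = P*S, hence S is normal, and the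
   third equation becomes P*P = 1; off the distinguished boundary
   |S - s|^2 + |P - p|^2 is then bounded below, hence invertible by Lax-Milgram,
   and its inverse gives exactness of the Koszul complex.
   That the Shilov boundary is {|p| = 1, s = conj(s) p, |s| <= 2} follows from the
   maximum principle on the bidisc, deduced from Goursat's lemma in logarithmic
   coordinates, and from explicit quadratic peak functions. *)
Require Import Defs.
From HB Require Import structures.
From mathcomp Require Import all_boot all_order all_algebra.
From mathcomp Require Import all_classical all_reals all_analysis.
From mathcomp Require Import sesquilinear complex.
From mathcomp Require Import ring lra.
Set Implicit Arguments.
Unset Strict Implicit.
Unset Printing Implicit Defensive.
Import Order.TTheory GRing.Theory Num.Theory.
Import numFieldNormedType.Exports.
Local Open Scope classical_set_scope.
Local Open Scope ring_scope.
Local Open Scope complex_scope.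

Local Notation Re := complex.Re.
Local Notation Im := complex.Im.

(** * Goursat's lemma and the maximum principle *)

(** Until [S'] is known to commute with [P], the pair cannot be handled jointly with further
    operators. Hence [P'P = 1] comes first, and [S] enters there only at the end, to complete an
    approximate eigenvalue of [P] to a point of the Taylor spectrum. Each later relation is tested
    on joint approximate eigenvectors of the pair and of a selfadjoint operator that detects a
    failure of the relation: a vector violating it yields an approximate eigenvalue that the
    spectrum excludes.

    Both inclusions for the Shilov boundary are used, on opposite sides. The forward half needs that
    the image of the torus is a closed boundary, which is the maximum principle; the converse needs
    that every closed boundary contains all points satisfying the equations, which is what peak
    functions give. Logarithmic coordinates turn circles about 0 into vertical segments with
    periodic data, so that Goursat's lemma for rectangles suffices. In the passage to the Koszul
    complex, an explicit gliding hump does the work of the open mapping theorem. *)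

Lemma quartering (R : realType) (L M a0 c0 : R) (Bad : nat -> R -> R -> Prop) :
  0 <= L -> 0 <= M ->
  (forall n a c, Bad n a c -> exists i j : bool,
     Bad n.+1 (a + i%:R * (L * 2^-1 ^+ n.+1)) (c + j%:R * (M * 2^-1 ^+ n.+1))) ->
  Bad 0%N a0 c0 ->
  exists x y, [/\ a0 <= x <= a0 + L, c0 <= y <= c0 + M & forall n, exists a c,
    [/\ Bad n a c, a <= x <= a + L * 2^-1 ^+ n, c <= y <= c + M * 2^-1 ^+ n,
        a0 <= a /\ a + L * 2^-1 ^+ n <= a0 + L &
        c0 <= c /\ c + M * 2^-1 ^+ n <= c0 + M]].
Proof.
move=> L0 M0 hbad bad0.
have step (q : nat * (R * R)) : exists p : R * R, Bad q.1 q.2.1 q.2.2 ->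
    Bad q.1.+1 p.1 p.2 /\ exists i j : bool,
      p.1 = q.2.1 + i%:R * (L * 2^-1 ^+ q.1.+1) /\
      p.2 = q.2.2 + j%:R * (M * 2^-1 ^+ q.1.+1).
  case: (pselect (Bad q.1 q.2.1 q.2.2)) => [b|nb]; last by exists (0, 0).
  have [i [j bij]] := hbad _ _ _ b; eexists (_, _) => _; split; first exact: bij.
  by exists i, j.
have [f fP] := choice step.
pose p := fix p n := if n is m.+1 then f (m, p m) else (a0, c0).
have pbad n : Bad n (p n).1 (p n).2.
  by elim: n => // n /(fP (n, p n)) [].
pose a n := (p n).1; pose c n := (p n).2.
have ac n : exists i j : bool, a n.+1 = a n + i%:R * (L * 2^-1 ^+ n.+1) /\
    c n.+1 = c n + j%:R * (M * 2^-1 ^+ n.+1).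
  by have [_] := fP (n, p n) (pbad n).
(* The coordinates are treated separately. The common point of the nested intervals is the supremum
   of their left ends, each of which lies below every right end by [cross]. *)
have nest (K : R) (s : nat -> R) : 0 <= K ->
    (forall n, exists i : bool, s n.+1 = s n + i%:R * (K * 2^-1 ^+ n.+1)) ->
    exists2 z, s 0%N <= z <= s 0%N + K & forall n,
      s n <= z <= s n + K * 2^-1 ^+ n /\
      (s 0%N <= s n /\ s n + K * 2^-1 ^+ n <= s 0%N + K).
  move=> K0 hs.
  have pw n : 0 <= K * 2^-1 ^+ n by rewrite mulr_ge0// exprn_ge0// invr_ge0.
  have mono n : s n <= s n.+1 /\ s n.+1 + K * 2^-1 ^+ n.+1 <= s n + K * 2^-1 ^+ n.
    have [i ->] := hs n; have := pw n.+1; have := pw n; rewrite exprS.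
    by case: i => /= p1 p2; split; lra.
  have upto n m : s n <= s (n + m)%N /\
      s (n + m)%N + K * 2^-1 ^+ (n + m)%N <= s n + K * 2^-1 ^+ n.
    elim: m => [|m [h1 h2]]; first by rewrite addn0.
    by have [g1 g2] := mono (n + m)%N; rewrite addnS; split; lra.
  have cross n m : s n <= s m + K * 2^-1 ^+ m.
    have [nm|mn] := leqP n m.
      have [+ _] := upto n (m - n)%N; rewrite subnKC// => h.
      by apply: (le_trans h); rewrite lerDl.
    have [_ +] := upto m (n - m)%N; rewrite subnKC; last exact: ltnW.
    by have := pw n; lra.
  have hsup : has_sup (range s).
    split; first by exists (s 0%N), 0%N.
    by exists (s 0%N + K * 2^-1 ^+ 0) => _ [n _ <-]; exact: cross.
  have ub n : s n <= sup (range s).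
    by apply: sup_upper_bound => //; exists n.
  have lb n : sup (range s) <= s n + K * 2^-1 ^+ n.
    by apply: ge_sup; [exists (s 0%N), 0%N|move=> _ [m _ <-]; exact: cross].
  exists (sup (range s)); first by rewrite ub/=; have := lb 0%N; rewrite expr0 mulr1.
  move=> n; rewrite ub lb/=; split => //.
  by have := upto 0%N n; rewrite add0n expr0 mulr1.
have [||x xa hx] := nest L a => //.
  by move=> n; have [i [j [? _]]] := ac n; exists i.
have [||y yc hy] := nest M c => //.
  by move=> n; have [i [j [_ ?]]] := ac n; exists j.
exists x, y; split => // n; exists (a n), (c n).
by have [? ?] := hx n; have [? ?] := hy n; split.
Qed.

(** The complex derivative of [u + i v] is [al + i be]. This is total differentiability with a
    Cauchy-Riemann matrix; partial derivatives alone would not give the estimate on small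
    rectangles. *)
Definition cauchy_riemann (R : realType) (u v : R -> R -> R) (x y : R) :=
  exists al be, forall e, 0 < e -> exists2 d, 0 < d & forall x' y',
    `|x' - x| < d -> `|y' - y| < d ->
    `|u x' y' - u x y - (al * (x' - x) - be * (y' - y))| <=
      e * (`|x' - x| + `|y' - y|) /\
    `|v x' y' - v x y - (be * (x' - x) + al * (y' - y))| <=
      e * (`|x' - x| + `|y' - y|).

(** Line integrals enter only as increments of primitives, so that the mean value theorem does the
    work of integral estimates. *)
Definition primitive_on (R : realType) (F f : R -> R) (a b : R) :=
  (forall x, x \in `]a, b[%R -> is_derive x 1 F (f x)) /\
  {within `[a, b], continuous F}.

Lemma primitive_onW (R : realType) (F f : R -> R) (a b a' b' : R) :
  a <= a' -> b' <= b -> primitive_on F f a b -> primitive_on F f a' b'.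
Proof.
move=> aa bb [h1 h2]; split.
  move=> x; rewrite in_itv/= => /andP[h h']; apply: h1; rewrite in_itv/=.
  by rewrite (le_lt_trans aa h) (lt_le_trans h' bb).
apply: continuous_subspaceW h2 => x /=; rewrite !in_itv/= => /andP[h h'].
by rewrite (le_trans aa h) (le_trans h' bb).
Qed.

Lemma primitive_affine_approx (R : realType) (F f : R -> R) (p q k m z e : R) :
  p <= q -> primitive_on F f p q ->
  (forall s, p <= s <= q -> `|f s - (k + m * (s - z))| <= e) ->
  `|F q - F p - (k * (q - p) + m * ((q - z) ^+ 2 - (p - z) ^+ 2) / 2)|
    <= e * (q - p).
Proof.
move=> pq [dF cF] hf.
pose A (s : R) := k * s + (m / 2) * (s - z) ^+ 2.
have dA (x : R) : is_derive x (1:R) A (k + m * (x - z)).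
  rewrite /A; apply: is_derive_eq.
  by rewrite /GRing.scale /=; field.
have [||s sI hs] := @MVT_segment R (F - A) (fun s => f s - (k + m * (s - z))) p q pq.
- move=> x xI; apply: is_deriveB; exact: dF.
- move=> x; apply: (@continuousB _ _ (subspace `[p, q]) F A); first exact: cF.
  apply: continuous_subspaceT => y.
  by apply: differentiable_continuous; apply/derivable1_diffP; apply: ex_derive.
have <- : F q - A q - (F p - A p) =
    F q - F p - (k * (q - p) + m * ((q - z) ^+ 2 - (p - z) ^+ 2) / 2).
  by rewrite /A; field.
rewrite (_ : F q - _ - _ = (f s - (k + m * (s - z))) * (q - p)); last exact: hs.
rewrite normrM (ger0_norm (_ : 0 <= q - p)) ?subr_ge0//.
by rewrite ler_wpM2r ?subr_ge0// hf//; rewrite in_itv in sI.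
Qed.

(* The form v dx + u dy is closed to first order at every point, so its
   integral over a rectangle of size t is o(t^2); bisecting a rectangle on
   which the integral does not vanish contradicts this. *)
Lemma goursat (R : realType) (u v X Y : R -> R -> R) (a L c M : R) :
  0 < L -> 0 < M ->
  (forall y, c <= y <= c + M -> primitive_on (X y) (fun x => v x y) a (a + L)) ->
  (forall x, a <= x <= a + L -> primitive_on (Y x) (u x) c (c + M)) ->
  (forall x y, a <= x <= a + L -> c <= y <= c + M -> cauchy_riemann u v x y) ->
  X c (a + L) - X c a + (Y (a + L) (c + M) - Y (a + L) c)
    - (X (c + M) (a + L) - X (c + M) a) - (Y a (c + M) - Y a c) = 0.
Proof.
move=> L0 M0 hX hY hCR.
pose I a c l m := X c (a + l) - X c a + (Y (a + l) (c + m) - Y (a + l) c)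
    - (X (c + m) (a + l) - X (c + m) a) - (Y a (c + m) - Y a c).
rewrite -/(I a c L M); apply/eqP/negPn/negP => nz.
(* Half of the integral makes the initial rectangle bad with a strict inequality. Badness scales
   like the area, by [4^-1] per step, so one of the four quarters stays bad. *)
pose e := `|I a c L M| / 2.
have e0 : 0 < e by rewrite divr_gt0// normr_gt0.
pose Bad n a c := e * (4^-1 ^+ n) < `|I a c (L * 2^-1 ^+ n) (M * 2^-1 ^+ n)|.
have [||||x [y [xI yI hn]]] := @quartering R L M a c Bad.
- exact: ltW.
- exact: ltW.
- move=> n p q; rewrite /Bad => h.
  set l := L * 2^-1 ^+ n.+1; set m := M * 2^-1 ^+ n.+1.
  have lE : L * 2^-1 ^+ n = l + l by rewrite /l exprS; field.
  have mE : M * 2^-1 ^+ n = m + m by rewrite /m exprS; field.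
  have split4 : I p q (l + l) (m + m) =
      I p q l m + I (p + l) q l m + I p (q + m) l m + I (p + l) (q + m) l m.
    by rewrite /I !addrA; ring.
  move: h; rewrite lE mE split4 => h.
  suff : ~ (forall i j : bool, `|I (p + i%:R * l) (q + j%:R * m) l m| <=
      e * 4^-1 ^+ n.+1).
    move=> hh; apply: contrapT => h'; apply: hh => i j.
    rewrite leNgt; apply/negP => b; apply: h'; exists i, j.
    exact: b.
  move=> hh.
  have := hh false false; have := hh false true; have := hh true false.
  have := hh true true; rewrite /= !mul1r !mul0r !addr0 => h1 h2 h3 h4.
  have e4 : e * 4^-1 ^+ n = 4 * (e * 4^-1 ^+ n.+1) by rewrite exprS; field.
  have := ler_normD (I p q l m + I (p + l) q l m + I p (q + m) l m)
    (I (p + l) (q + m) l m).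
  have := ler_normD (I p q l m + I (p + l) q l m) (I p (q + m) l m).
  have := ler_normD (I p q l m) (I (p + l) q l m).
  by move: h; rewrite e4; lra.
- rewrite /Bad !expr0 !mulr1 /e; have : 0 < `|I a c L M| by rewrite normr_gt0.
  lra.
have [al [be hcr]] := hCR _ _ xI yI.
have LM : 0 < L + M by lra.
(* The errors of the four sides add up to [2 e' (L + M) ^ 2 t ^ 2], which is half of [e t ^ 2]. *)
pose e' := e / (4 * (L + M) ^+ 2).
have e'0 : 0 < e' by rewrite divr_gt0// mulr_gt0// exprn_gt0.
have [d d0 hd] := hcr _ e'0.
have [n nd] : exists n, 2^-1 ^+ n * (L + M) < d.
  have : (2^-1 : R) ^+ n @[n --> \oo] --> (0:R).
    by apply: cvg_expr; rewrite ger0_norm ?invr_ge0// invf_lt1// ltr1n.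
  move=> /cvgr0Pnorm_lt /(_ (d / (L + M))).
  rewrite divr_gt0// => /(_ isT) [n _ /(_ n (leqnn n)) /= h].
  exists n; rewrite -ltr_pdivlMr//; apply: le_lt_trans h; exact: ler_norm.
have [p [q [bad pxI qyI [pa pb] [qa qb]]]] := hn n.
set t := 2^-1 ^+ n in nd bad pxI qyI pa pb qa qb.
have t0 : 0 < t by rewrite exprn_gt0// invr_gt0.
have tt : 4^-1 ^+ n = t ^+ 2.
  rewrite /t exprAC; congr (_ ^+ _).
  by rewrite exprVn expr2 -natrM.
move: bad; rewrite /Bad -/t tt; apply/negP; rewrite -leNgt.
have Lt0 : 0 < L * t by rewrite mulr_gt0.
have Mt0 : 0 < M * t by rewrite mulr_gt0.
have small x' y' : p <= x' <= p + L * t -> q <= y' <= q + M * t ->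
    `|u x' y' - u x y - (al * (x' - x) - be * (y' - y))| <= e' * ((L + M) * t) /\
    `|v x' y' - v x y - (be * (x' - x) + al * (y' - y))| <= e' * ((L + M) * t).
  move=> x'I y'I.
  have dx : `|x' - x| <= L * t by rewrite ler_norml; lra.
  have dy : `|y' - y| <= M * t by rewrite ler_norml; lra.
  have [||h1 h2] := hd x' y'.
  - by apply: le_lt_trans dx (le_lt_trans _ nd); nra.
  - by apply: le_lt_trans dy (le_lt_trans _ nd); nra.
  have le2 : e' * (`|x' - x| + `|y' - y|) <= e' * ((L + M) * t).
    by rewrite ler_wpM2l ?(ltW e'0)//; lra.
  by split; [exact: le_trans h1 le2|exact: le_trans h2 le2].
have sideX y' : q <= y' <= q + M * t ->
    `|X y' (p + L * t) - X y' p - ((v x y + al * (y' - y)) * (p + L * t - p) +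
      be * ((p + L * t - x) ^+ 2 - (p - x) ^+ 2) / 2)|
    <= e' * ((L + M) * t) * (p + L * t - p).
  move=> y'I; apply: (@primitive_affine_approx _ _ (fun x' => v x' y')); first by lra.
    by apply: primitive_onW (hX y' _); lra.
  move=> s sI; have [_] := small s y' sI y'I; congr (`|_| <= _); ring.
have sideY x' : p <= x' <= p + L * t ->
    `|Y x' (q + M * t) - Y x' q - ((u x y + al * (x' - x)) * (q + M * t - q) +
      (- be) * ((q + M * t - y) ^+ 2 - (q - y) ^+ 2) / 2)|
    <= e' * ((L + M) * t) * (q + M * t - q).
  move=> x'I; apply: (@primitive_affine_approx _ _ (u x')); first by lra.
    by apply: primitive_onW (hY x' _); lra.
  move=> s sI; have [+ _] := small x' s x'I sI; congr (`|_| <= _); ring.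
have := sideX q; have := sideX (q + M * t); have := sideY p.
have := sideY (p + L * t).
rewrite !lexx !lerDl !(ltW Lt0) !(ltW Mt0) => /(_ isT) + /(_ isT) + /(_ isT) + /(_ isT).
set A1 := Y _ _ - _ - _; set A2 := Y p _ - _ - _; set A3 := X _ _ - _ - _.
set A4 := X q _ - _ - _ => h1 h2 h3 h4.
(* The affine parts cancel around the rectangle, because the first-order part of [v dx + u dy] at
   [(x, y)] is a closed form. *)
have -> : I p q (L * t) (M * t) = A4 + A1 - A3 - A2.
  by rewrite /I /A1 /A2 /A3 /A4; field.
have e1 : e' * ((L + M) * t) * (p + L * t - p) * 2 +
  e' * ((L + M) * t) * (q + M * t - q) * 2 = e * t ^+ 2 / 2.
  by rewrite /e'; field; rewrite gt_eqF.
have : 0 < e * t ^+ 2 by rewrite mulr_gt0// exprn_gt0.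
have := ler_normB (A4 + A1 - A3) A2; have := ler_normB (A4 + A1) A3.
by have := ler_normD A4 A1; lra.
Qed.

Lemma continuous_primitive (R : realType) (f : R -> R) (a b : R) :
  continuous f -> exists F, primitive_on F f a b.
Proof.
move=> cf; pose mu := @lebesgue_measure R.
(* Starting at [a - 1] makes [F] derivable at [a] itself, which gives continuity on the closed
   interval. *)
pose F x := (\int[mu]_(t in `[a - 1, x]) f t)%R.
exists F.
have dF (x : R) : a - 1 < x -> is_derive x (1 : R) F (f x).
  move=> ax.
  have intf : mu.-integrable `[a - 1, x + 1] (EFin \o f).
    by apply: continuous_compact_integrable; [exact: segment_compact|exact: continuous_subspaceT].
  have [|h1 h2] := @continuous_FTC1_closed R f (a - 1) x (x + 1) _ intf ax (cf x).
  - by rewrite ltrDl.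
  - by rewrite -h2 derive1E; apply: DeriveDef.
split.
  by move=> x; rewrite in_itv/= => /andP[h _]; apply: dF; lra.
apply: derivable_within_continuous => x; rewrite in_itv/= => /andP[h _].
have := dF x; rewrite (_ : a - 1 < x) => [|]; last by lra.
by move=> /(_ isT) ?; apply: ex_derive.
Qed.

Lemma cauchy_riemann_continuousX (R : realType) (u v : R -> R -> R) (x y : R) :
  cauchy_riemann u v x y -> {for x, continuous (fun x => v x y)}.
Proof.
move=> [al [be h]]; have [d d0 hd] := h 1 ltr01.
have C0 : 0 < `|be| + 1 by rewrite ltr_wpDl.
apply/cvgrPdist_le => e e0; apply/nbhs_ballP.
exists (Num.min d (e / (`|be| + 1))); first by rewrite /= lt_min d0 divr_gt0.
move=> t; rewrite /ball/= lt_min distrC => /andP[td te].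
have [||_] := hd t y => //; first by rewrite subrr normr0.
rewrite subrr normr0 mulr0 !addr0 mul1r => h1.
have : `|v t y - v x y| <= (`|be| + 1) * `|t - x|.
  have := ler_normD (v t y - v x y - be * (t - x)) (be * (t - x)).
  by rewrite subrK normrM; lra.
rewrite distrC => /le_trans; apply; rewrite mulrC -ler_pdivlMr//; exact: ltW.
Qed.

Lemma cauchy_riemann_continuousY (R : realType) (u v : R -> R -> R) (x y : R) :
  cauchy_riemann u v x y -> {for y, continuous (u x)}.
Proof.
move=> h; apply: (@cauchy_riemann_continuousX R (fun y x => v x y) (fun y x => u x y)).
have [al [be hh]] := h; exists al, (- be) => e e0; have [d d0 hd] := hh e e0.
exists d => // y' x' hy hx; have [h1 h2] := hd x' y' hx hy.
by split; rewrite [_ + `|x' - x|]addrC;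
  [move: h2|move: h1]; congr (`|_| <= _); ring.
Qed.

(* On [x <= 0], [w |-> f (exp w)] is such a pair of period [T = 2 pi]: in Goursat's
   identity the horizontal sides cancel, so [u a] and [u b] have the same mean
   over a period, hence a common value. *)
Lemma periodic_common_value (R : realType) (u v : R -> R -> R) (a b T : R) :
  a < b -> 0 < T ->
  (forall x y, a <= x <= b -> cauchy_riemann u v x y) ->
  (forall x, v x T = v x 0) ->
  exists y1 y2, u a y1 = u b y2.
Proof.
move=> ab T0 hCR vT.
(* Composition with [clamp] extends [v] continuously beyond [[a, b]], since [continuous_primitive]
   asks for continuity on the whole line. *)
pose clamp (x : R) := Num.max a (Num.min x b).
have clampI x : a <= clamp x <= b.
  by rewrite /clamp le_max lexx/= ge_max (ltW ab) ge_min lexx orbT.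
have clampE x : a <= x <= b -> clamp x = x.
  by move=> /andP[h1 h2]; rewrite /clamp min_l// max_r.
have cclamp : continuous clamp.
  have lip x y : `|clamp x - clamp y| <= `|x - y|.
    have mnP (s : R) : Num.min s b = s /\ s <= b \/ Num.min s b = b /\ b <= s.
      by case: (leP s b) => /= [|/ltW]; [left|right].
    have mxP (s : R) : Num.max a s = a /\ s <= a \/ Num.max a s = s /\ a <= s.
      by case: (leP a s) => /= [|/ltW]; [right|left].
    rewrite /clamp ler_norml.
    have := ler_norm (x - y); have := ler_norm (- (x - y)); rewrite normrN.
    by case: (mnP x) => -[-> ?]; case: (mnP y) => -[-> ?];
      case: (mxP x) => -[? ?]; case: (mxP y) => -[? ?]; case: (mxP b) => -[? ?]; lra.
  move=> x; apply/cvgrPdist_le => e e0; apply/nbhs_ballP; exists e => // y.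
  by rewrite /ball/= => /ltW; exact: le_trans.
have hX y : exists F, primitive_on F (fun x => v x y) a b.
  have [|F [h1 h2]] := @continuous_primitive R (fun x => v (clamp x) y) a b.
    move=> x; apply: (@continuous_comp _ _ _ clamp (fun x => v x y)); first exact: cclamp.
    by apply: cauchy_riemann_continuousX; exact: hCR.
  exists F; split=> // x xI; have := h1 x xI; rewrite clampE//.
  by move: xI; rewrite in_itv/= => /andP[/ltW -> /ltW ->].
have hY x : exists F, a <= x <= b -> primitive_on F (u x) 0 T.
  case: (pselect (a <= x <= b)) => [xI|nx]; last by exists (u x).
  have [|F hF] := @continuous_primitive R (u x) 0 T; last by exists F.
  by move=> y; apply: cauchy_riemann_continuousY; exact: hCR.
have [X0 hX0] := choice hX; have [Y hY0] := choice hY.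
(* The primitives come from a choice; taking the same one at heights [0] and [T] makes the two
   horizontal sides cancel exactly. *)
pose X y := if y == T then X0 0 else X0 y.
have X0T : X 0 = X T by rewrite /X eqxx; case: ifP.
have := @goursat R u v X Y a (b - a) 0 T.
rewrite subr_gt0 [a + _]addrC subrK add0r => /(_ ab T0).
rewrite X0T => H.
have /eqP : Y b T - Y b 0 - (Y a T - Y a 0) = 0.
  rewrite -[RHS]H; first by ring.
  - move=> y _; rewrite /X; case: eqP => [->|_]; last exact: hX0.
    by under eq_fun do rewrite vT; exact: hX0.
  - by move=> x /hY0.
  - by move=> x y xI _; exact: hCR.
rewrite subr_eq0 => /eqP e.
have mv x : a <= x <= b -> exists2 y, y \in `[0, T]%R & Y x T - Y x 0 = u x y * T.
  move=> /hY0[h1 h2]; have [y yI hy] := MVT_segment (ltW T0) h1 h2.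
  by exists y => //; rewrite hy subr0.
have [|y1 _ e1] := mv a; first by rewrite lexx ltW.
have [|y2 _ e2] := mv b; first by rewrite lexx ltW.
exists y1, y2; apply: (@mulIf _ T); first by rewrite gt_eqF.
by rewrite -e1 -e2.
Qed.

(** * Complex derivatives, the exponential, and the maximum principle on the disc *)

Lemma realC_gt0 (R : realType) (e : R[i]) : 0 < e -> exists2 r : R, 0 < r & e = r%:C.
Proof.
case: e => a b; rewrite ltcE/= => /andP[/eqP -> a0]; by exists a.
Qed.

(** The field is general so that the same criterion serves complex derivatives and the real
    functions [expR], [cos], [sin] inside [cexp]. *)
Lemma is_derive_distP (K : numFieldType) (k : K^o -> K^o) (w c : K^o) :
  is_derive w 1 k c <-> forall e : K, 0 < e -> exists2 d : K, 0 < d &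
    forall z : K, `|z - w| < d -> `|k z - k w - c * (z - w)| <= e * `|z - w|.
Proof.
have <- : ((fun h => h^-1 *: (k (h *: 1 + w) - k w)) @ 0^' --> c) <-> is_derive w 1 k c.
  split=> [h|[h1 h2]]; last by rewrite -h2.
  by apply: DeriveDef; [apply/cvg_ex; exists c|apply/cvg_lim].
split.
  move=> hc e e0.
  move: hc => /cvgrPdist_le /(_ e e0) /nbhs_ballP[d d0 hd]; exists d => // z zd.
  have [->|zw] := eqVneq z w; first by rewrite !subrr mulr0 subrr normr0 mulr0.
  have zw0 : z - w != 0 by rewrite subr_eq0.
  have /hd : ball (0 : K^o) d (z - w) by rewrite /ball/= sub0r normrN.
  move=> /(_ zw0) /=.
  have -> : (z - w)%:A + w = z :> K^o by rewrite /GRing.scale/= mulr1 subrK.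
  rewrite distrC => h.
  rewrite -ler_pdivrMr ?normr_gt0// -normfV -normrM.
  apply: le_trans h; rewrite le_eqVlt; apply/orP; left; apply/eqP; congr (`|_|).
  by rewrite /GRing.scale/= mulrBl; field.
move=> hc; apply/cvgrPdist_le => e e0.
have [d d0 hd] := hc e e0; apply/nbhs_ballP; exists d => //.
move=> h; rewrite /ball/= sub0r normrN => hh h0.
have -> : h%:A = h :> K^o by rewrite /GRing.scale/= mulr1.
have := hd (h + w); rewrite addrK => /(_ hh).
rewrite -ler_pdivrMr ?normr_gt0// -normfV -normrM => H; rewrite distrC.
apply: le_trans H; rewrite le_eqVlt; apply/orP; left; apply/eqP; congr (`|_|).
by rewrite /GRing.scale/=; field.
Qed.

Lemma is_deriveC_distP (R : realType) (k : R[i]^o -> R[i]^o) (w c : R[i]^o) :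
  is_derive w 1 k c <-> forall e : R, 0 < e -> exists2 d : R, 0 < d &
    forall z : R[i], `|z - w| < d%:C -> `|k z - k w - c * (z - w)| <= e%:C * `|z - w|.
Proof.
split=> [/is_derive_distP h e e0|h].
  have [|_ /realC_gt0[d d0 ->] hd] := h e%:C; first by rewrite ltcR.
  by exists d.
apply/is_derive_distP => _ /realC_gt0[e e0 ->]; have [d d0 hd] := h e e0.
by exists d%:C; rewrite ?ltcR.
Qed.

Lemma normC_le_ReIm (R : realType) (z : R[i]) : `|z| <= (`|Re z| + `|Im z|)%:C.
Proof.
rewrite normc_def lecR -[leRHS]ger0_norm ?addr_ge0// -sqrtr_sqr.
rewrite ler_sqrt ?sqr_ge0// sqrrD !real_normK ?num_real//.
by have := mulr_ge0 (normr_ge0 (Re z)) (normr_ge0 (Im z)); lra.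
Qed.

Lemma normC_ge_Im (R : realType) (z : R[i]) : `|Im z|%:C <= `|z|.
Proof.
rewrite normc_def lecR -sqrtr_sqr ler_sqrt ?addr_ge0 ?sqr_ge0//.
by rewrite lerDr sqr_ge0.
Qed.

Lemma derivable_cauchy_riemann (R : realType) (k : R[i]^o -> R[i]^o) (x y : R) :
  derivable k (x +i* y) 1 ->
  cauchy_riemann (fun x y => Re (k (x +i* y))) (fun x y => Im (k (x +i* y))) x y.
Proof.
move=> /derivableP; set c := 'D_1 k _ => /is_deriveC_distP h.
exists (Re c), (Im c) => e e0; have [d d0 hd] := h e e0.
exists (d / 2); first by rewrite divr_gt0.
move=> x' y' xd yd.
have le1 : `|(x' +i* y') - (x +i* y)| <= (`|x' - x| + `|y' - y|)%:C.
  exact: (normC_le_ReIm ((x' +i* y') - (x +i* y))).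
have /hd le2 : `|(x' +i* y') - (x +i* y)| < d%:C.
  by apply: le_lt_trans le1 _; rewrite ltcR; lra.
have {}le2 := le_trans le2 (ler_wpM2l _ le1).
have {}le2 := le2 _; rewrite lecR (ltW e0) -rmorphM/= in le2.
move/(_ isT) : le2.
set r := _ - c * _ => le2.
have rE : r = (Re (k (x' +i* y')) - Re (k (x +i* y)) -
    (Re c * (x' - x) - Im c * (y' - y))) +i*
    (Im (k (x' +i* y')) - Im (k (x +i* y)) - (Im c * (x' - x) + Re c * (y' - y))).
  rewrite /r; case: (c) (k _) (k _) => c1 c2 [a1 a2] [b1 b2] /=.
  by apply/eqP; rewrite eq_complex/=; apply/andP; split; apply/eqP; ring.
have := le_trans (normc_ge_Re r) le2; have := le_trans (normC_ge_Im r) le2.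
by rewrite !lecR rE/=.
Qed.

Definition cexp (R : realType) (z : R[i]) : R[i] :=
  (expR (Re z) * cos (Im z)) +i* (expR (Re z) * sin (Im z)).

Lemma cexpD (R : realType) (z w : R[i]) : cexp (z + w) = cexp z * cexp w.
Proof.
case: z w => [a b] [c d]; rewrite /cexp/= expRD cosD sinD.
by apply/eqP; rewrite eq_complex/=; apply/andP; split; apply/eqP; ring.
Qed.

Lemma cexp_periodic (R : realType) (x : R) : cexp (x +i* (pi *+ 2)) = cexp (x +i* 0).
Proof. by rewrite /cexp/= cos2pi sin2pi cos0 sin0. Qed.

Lemma norm_cexp (R : realType) (z : R[i]) : `|cexp z| = (expR (Re z))%:C.
Proof.
rewrite normc_def/= !exprMn -mulrDr cos2Dsin2 mulr1 sqrtr_sqr.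
by rewrite ger0_norm// expR_ge0.
Qed.

Lemma is_derive_cexp (R : realType) (w : R[i]) :
  is_derive (w : R[i]^o) 1 (@cexp R : R[i]^o -> R[i]^o) (cexp w).
Proof.
apply/is_deriveC_distP => e e0.
have Ew0 : 0 < expR (Re w) by exact: expR_gt0.
(* By multiplicativity only the derivative at 0 matters. There 9 is [1 + 3 + 4 + 1], from
   [expR a - 1 - a], [expR a (cos b - 1)], [(expR a - 1) sin b] and [sin b - b]. *)
pose e1 := Num.min 1 (e / (9 * expR (Re w))).
have e10 : 0 < e1 by rewrite lt_min ltr01 divr_gt0// mulr_gt0.
have e1le1 : e1 <= 1 by rewrite ge_min lexx.
have e1e : expR (Re w) * (9 * e1) <= e.
  have : e1 <= e / (9 * expR (Re w)) by rewrite ge_min lexx orbT.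
  by rewrite ler_pdivlMr ?mulr_gt0//; lra.
clearbody e1.
have near0 (f : R -> R) f' : is_derive (0 : R^o) 1 (f : R^o -> R^o) f' ->
    exists2 d, 0 < d & forall h, `|h| < d -> `|f h - f 0 - f' * h| <= e1 * `|h|.
  move=> /is_derive_distP /(_ e1 e10)[d d0 hd]; exists d => // h hh.
  by have := hd h; rewrite subr0; exact.
have [d1 d10 h1] : exists2 d, 0 < d &
    forall h, `|h| < d -> `|expR h - expR 0 - 1 * h| <= e1 * `|h|.
  by apply: near0; rewrite -[X in is_derive _ _ _ X](@expR0 R); exact: is_derive_expR.
have [d2 d20 h2] : exists2 d, 0 < d &
    forall h, `|h| < d -> `|cos h - cos 0 - 0 * h| <= e1 * `|h|.
  apply: near0; rewrite -[X in is_derive _ _ _ X]oppr0 -[X in - X](@sin0 R).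
  exact: is_derive_cos.
have [d3 d30 h3] : exists2 d, 0 < d &
    forall h, `|h| < d -> `|sin h - sin 0 - 1 * h| <= e1 * `|h|.
  by apply: near0; rewrite -[X in is_derive _ _ _ X](@cos0 R); exact: is_derive_sin.
pose d := Num.min (Num.min d1 d2) (Num.min d3 e1).
exists d => [|z]; first by rewrite /d !lt_min d10 d20 d30 e10.
have -> : cexp z = cexp w * cexp (z - w) by rewrite -cexpD addrC subrK.
have : `|Re (z - w)|%:C <= `|z - w| by exact: normc_ge_Re.
have : `|Im (z - w)|%:C <= `|z - w| by exact: normC_ge_Im.
set h := z - w; move=> hI hR hd.
have Rd : `|Re h| < d by rewrite -ltcR; exact: le_lt_trans hd.
have Id : `|Im h| < d by rewrite -ltcR; exact: le_lt_trans hd.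
rewrite -[X in _ - X - _]mulr1 -mulrBr -mulrBr normrM norm_cexp.
have key : `|cexp h - 1 - h| <= (9 * e1)%:C * `|h|.
  rewrite mulrC; apply: (le_trans (normC_le_ReIm _)).
  move: h hI hR hd Rd Id => [a b] /=; rewrite /cexp/= => hI hR hd.
  rewrite !lt_min => /andP[/andP[ad1 ad2] /andP[ad3 ade]].
  move=> /andP[/andP[bd1 bd2] /andP[bd3 bde]].
  have := h1 a ad1; have := h2 b bd2; have := h3 b bd3.
  rewrite expR0 cos0 sin0 mul0r !subr0 !mul1r => hs hc he.
  have [N NE] : exists N : R, `|a +i* b| = N%:C by rewrite normc_def; eexists.
  move: hI hR; rewrite NE -rmorphM/= !lecR ?(oppr0, addr0) => hI hR.
  have Ea : `|expR a - 1| <= 2 * `|a|.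
    have := ler_normD (expR a - 1 - a) a; rewrite subrK => /le_trans; apply.
    by have := ler_wpM2r (normr_ge0 a) e1le1; lra.
  have Ea3 : expR a <= 3 by have := ler_norm (expR a - 1); lra.
  have sb : `|sin b| <= 2 * `|b|.
    have := ler_normD (sin b - b) b; rewrite subrK => /le_trans; apply.
    by have := ler_wpM2r (normr_ge0 b) e1le1; lra.
  have -> : expR a * cos b - 1 - a = (expR a - 1 - a) + expR a * (cos b - 1) by ring.
  have -> : expR a * sin b - b = (expR a - 1) * sin b + (sin b - b) by ring.
  have := ler_normD (expR a - 1 - a) (expR a * (cos b - 1)).
  have := ler_normD ((expR a - 1) * sin b) (sin b - b).
  rewrite !normrM (ger0_norm (expR_ge0 a)) => i1 i2.
  have j1 := ler_wpM2l (expR_ge0 a) hc.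
  have eb : 0 <= e1 * `|b| by rewrite mulr_ge0// ltW.
  have j2 := ler_wpM2r eb Ea3.
  have j3 : `|expR a - 1| * `|sin b| <= 2 * e1 * (2 * `|b|).
    by apply: ler_pM => //; lra.
  have k1 := ler_wpM2l (ltW e10) hI; have k2 := ler_wpM2l (ltW e10) hR.
  lra.
apply: le_trans (ler_wpM2l _ key) _; first by rewrite ler0c ltW.
by rewrite mulrA -rmorphM/= ler_wpM2r// lecR.
Qed.

(** On each circle about 0 of radius [expR a < 1] the real part of [g] takes a value that it also
    takes on the unit circle, hence one at most [M]. Circles small enough for continuity at 0 give
    the claim. *)
Lemma Re_center_le (R : realType) (g : R[i]^o -> R[i]^o) (M : R) :
  (forall z : R[i], `|z| <= 1 -> derivable g z 1) ->
  (forall z : R[i], `|z| = 1 -> Re (g z) <= M) -> Re (g 0) <= M.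
Proof.
move=> dg hM; apply/ler_addgt0Pr => e e0.
have /derivable1_diffP/differentiable_continuous cg : derivable g 0 1.
  by apply: dg; rewrite normr0.
move: cg => /cvgrPdist_le /(_ e%:C); rewrite ltcR => /(_ e0).
move=> /nbhs_ballP[_ /realC_gt0[d d0 ->] hd].
pose a := Num.min (-1) (ln d - 1).
have a0 : a < 0 by rewrite gt_min ltrN10.
have ad : expR a < d.
  rewrite -[ltRHS]lnK ?posrE// ltr_expR; apply: (@le_lt_trans _ _ (ln d - 1)).
    by rewrite ge_min lexx orbT.
  by rewrite gtrBl.
pose k : R[i]^o -> R[i]^o := g \o @cexp R.
have CR x y : a <= x <= 0 -> cauchy_riemann (fun x y => Re (k (x +i* y)))
    (fun x y => Im (k (x +i* y))) x y.
  move=> /andP[_ x0]; apply: derivable_cauchy_riemann; apply/derivable1_diffP.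
  apply: differentiable_comp.
    by apply/derivable1_diffP; have ? := is_derive_cexp (x +i* y); exact: ex_derive.
  apply/derivable1_diffP; apply: dg; rewrite norm_cexp/= lecR expR_le1//.
have [||y1 [y2 hy]] := periodic_common_value a0 _ CR (T := pi *+ 2).
- by rewrite mulrn_wgt0// pi_gt0.
- by move=> x; rewrite /k/= cexp_periodic.
have h2 : Re (k (0 +i* y2)) <= M by apply: hM; rewrite norm_cexp/= expR0.
have := hd (cexp (a +i* y1)); rewrite /ball/= sub0r normrN norm_cexp ltcR => /(_ ad).
move=> /(le_trans (normc_ge_Re _)); rewrite lecR raddfB/= => /(le_trans (ler_norm _)).
by move: h2; rewrite -hy /k/=; lra.
Qed.

Lemma conjcD (R : rcfType) (x y : R[i]) : conjc (x + y) = conjc x + conjc y.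
Proof. exact: rmorphD. Qed.

Lemma conjcM (R : rcfType) (x y : R[i]) : conjc (x * y) = conjc x * conjc y.
Proof. exact: rmorphM. Qed.

(** The disc automorphism [phi] moves 0 to [a], and the factor [u] rotates [g a] to its modulus,
    which reduces the claim to the real part at the center. The identity [nE] shows that [phi]
    preserves the disc and the circle. *)
Lemma max_modulus_disc (R : realType) (g : R[i]^o -> R[i]^o) (M : R) (a : R[i]) :
  (forall z : R[i], `|z| <= 1 -> derivable g z 1) ->
  (forall z : R[i], `|z| = 1 -> `|g z| <= M%:C) -> `|a| < 1 -> `|g a| <= M%:C.
Proof.
move=> dg hM a1.
pose phi (z : R[i]^o) : R[i]^o := (z + a) / (1 + conjc a * z).
have nE (z : R[i]) : `|1 + conjc a * z| ^+ 2 - `|z + a| ^+ 2 = (1 - `|a| ^+ 2) * (1 - `|z| ^+ 2).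
  rewrite !sqr_normc !conjcD conjcM conjcK conjc1; ring.
have den (z : R[i]) : `|z| <= 1 -> 1 + conjc a * z != 0.
  move=> z1; apply/eqP => h; have : `|conjc a * z| = 1.
    by rewrite -[LHS]normrN -[X in `|X|]add0r -h addrK normr1.
  rewrite normrM normcJ => e1; suff : `|a| * `|z| < 1 by rewrite e1 ltxx.
  by rewrite -[ltRHS]mulr1; apply: le_lt_trans (ler_wpM2l _ z1) _; rewrite ?mulr1.
have a2 : 0 <= 1 - `|a| ^+ 2 by rewrite subr_ge0 expr_le1// ltW.
have phi_le1 (z : R[i]) : `|z| <= 1 -> `|phi z| <= 1.
  move=> z1; rewrite normrM normfV ler_pdivrMr ?normr_gt0 ?den// mul1r.
  rewrite -(@ler_pXn2r _ 2) ?nnegrE// -subr_ge0 nE mulr_ge0//.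
  by rewrite subr_ge0 expr_le1.
have phi_eq1 (z : R[i]) : `|z| = 1 -> `|phi z| = 1.
  move=> z1; have zl : `|z| <= 1 by rewrite z1.
  rewrite normrM normfV; apply: (mulIf (_ : `|1 + conjc a * z| != 0)).
    by rewrite normr_eq0 den.
  rewrite divfK ?normr_eq0 ?den// mul1r; apply/eqP.
  rewrite -(@eqrXn2 _ 2)// eq_sym -subr_eq0 nE z1 expr1n subrr mulr0//.
pose u : R[i] := if g a == 0 then 0 else `|g a| / g a.
have u1 : `|u| <= 1.
  rewrite /u; case: eqP => [_|/eqP h]; first by rewrite normr0.
  by rewrite normrM normfV normr_id divff// normr_eq0.
have uga : u * g a = `|g a|.
  by rewrite /u; case: eqP => [->|/eqP h]; rewrite ?mulr0 ?normr0// divfK.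
have : Re (u * g (phi 0)) <= M.
  apply: (@Re_center_le _ (fun z => u * g (phi z))) => z z1.
    apply: derivableM; first exact: derivable_cst.
    apply/derivable1_diffP; apply: (@differentiable_comp _ _ _ _ phi g).
      apply/derivable1_diffP; apply: derivableM; first by apply: derivableD.
      apply: derivableV; first exact: den.
      by apply: derivableD => //; apply: derivableM.
    by apply/derivable1_diffP; apply: dg; exact: phi_le1.
  rewrite -lecR.
  have := normc_ge_Re (u * g (phi z)); rewrite normrM => h.
  apply: le_trans (_ : `|Re (u * g (phi z))|%:C <= _); first by rewrite lecR ler_norm.
  apply: (le_trans h); rewrite -[leRHS]mul1r; apply: ler_pM => //.
  by apply: hM; exact: phi_eq1.
rewrite /phi mulr0 add0r addr0 divr1 uga normc_def /= => h.
by rewrite lecR.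
Qed.

(** * The distinguished boundary *)

Lemma continuous_Re (R : realType) : continuous (@complex.Re R : R[i]^o -> R).
Proof.
move=> z; apply/(@cvgrPdist_le _ _ _ (nbhs (z : R[i]^o))) => e e0.
apply/nbhs_ballP; exists e%:C; first by rewrite /= ltcR.
move=> w; rewrite /ball/= => /ltW/(le_trans (normc_ge_Re _)).
by rewrite lecR raddfB.
Qed.

Lemma continuous_real_complex (R : realType) : continuous (fun x : R => x%:C : R[i]^o).
Proof.
move=> x; apply/cvgrPdist_le => _ /realC_gt0[e e0 ->]; apply/nbhs_ballP.
exists e => // y; rewrite /ball/= => /ltW h.
by rewrite -rmorphB/= normc_def/= expr0n/= addr0 sqrtr_sqr lecR.
Qed.

Definition cis (R : realType) (t : R) : R[i] := cos t +i* sin t.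

Lemma continuous_cis (R : realType) : continuous (@cis R : R -> R[i]^o).
Proof.
have -> : @cis R = (fun t : R => (cos t)%:C + 'i * (sin t)%:C :> R[i]^o).
  apply/funext => t; rewrite /cis; apply/eqP; rewrite eq_complex/=.
  by apply/andP; split; apply/eqP; ring.
move=> t; apply: cvgD.
  apply: (@continuous_comp _ _ _ (@cos R) (fun x : R => x%:C : R[i]^o)).
    exact: continuous_cos.
  exact: continuous_real_complex.
apply: cvgM; first exact: cvg_cst.
apply: (@continuous_comp _ _ _ (@sin R) (fun x : R => x%:C : R[i]^o)).
  exact: continuous_sin.
exact: continuous_real_complex.
Qed.

Lemma norm_cis (R : realType) (t : R) : `|cis t| = 1.
Proof. by rewrite normc_def/= cos2Dsin2 sqrtr1. Qed.

Lemma cis_surj (R : realType) (z : R[i]) : `|z| = 1 ->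
  exists2 t : R, t \in `[- pi, pi]%R & z = cis t.
Proof.
case: z => x y; rewrite normc_def/= => -[h].
have xy : x ^+ 2 + y ^+ 2 = 1.
  rewrite -[LHS]sqr_sqrtr ?h ?expr1n// addr_ge0// sqr_ge0//.
have xI : -1 <= x <= 1 by have := sqr_ge0 y; move=> ?; apply/andP; split; nra.
have ac : acos x \in `[- pi, pi]%R /\ - acos x \in `[- pi, pi]%R.
  have := acos_ge0 xI; have := acos_lepi xI; have := pi_gt0 R.
  by rewrite !in_itv/= => *; split; apply/andP; split; lra.
have ca : cos (acos x) = x by rewrite acosK.
have sa : sin (acos x) = `|y|.
  by rewrite sin_acos// -sqrtr_sqr; congr Num.sqrt; lra.
have [y0|y0] := leP 0 y.
  by exists (acos x); [exact: ac.1|rewrite /cis ca sa ger0_norm].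
exists (- acos x); first exact: ac.2.
by rewrite /cis cosN sinN ca sa ltr0_norm// opprK.
Qed.

Definition symm (R : realType) (z1 z2 : R[i]^o) : R[i]^o * R[i]^o :=
  (z1 + z2, z1 * z2).

Lemma symm_Gamma (R : realType) (z1 z2 : R[i]) :
  `|z1| <= 1 -> `|z2| <= 1 -> @Gamma R (symm z1 z2).
Proof. by move=> h1 h2; exists (z1, z2). Qed.

(* A root z of [z ^ 2 - s' z + p'] with [1 < |z|] would satisfy
   [(1 - |z1|) (1 - |z2|) |z| <= |z - z1| |z - z2| <= |s' - s| |z| + |p' - p|]. *)
Lemma symm_interior (R : realType) (z1 z2 : R[i]) :
  `|z1| < 1 -> `|z2| < 1 -> (@Gamma R)° (symm z1 z2).
Proof.
move=> h1 h2.
have [r1 e1] : exists r : R, `|z1| = r%:C by rewrite normc_def; eexists.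
have [r2 e2] : exists r : R, `|z2| = r%:C by rewrite normc_def; eexists.
have r10 : 0 <= r1 by rewrite -ler0c -e1.
have r20 : 0 <= r2 by rewrite -ler0c -e2.
have r11 : r1 < 1 by rewrite -ltcR -e1.
have r21 : r2 < 1 by rewrite -ltcR -e2.
(* For [1 < |z|] the right side [d |z| + d] of the root estimate is below [2 d |z|], that is, below
   [(1 - r1) (1 - r2) |z|]. *)
pose d := (1 - r1) * (1 - r2) / 2.
have d0 : 0 < d by rewrite divr_gt0// mulr_gt0 ?subr_gt0.
apply/nbhs_ballP; exists d%:C; first by rewrite /= ltcR.
move=> [s p] [/=]; rewrite /ball/= => hs hp.
pose D := sqrtC (s ^+ 2 - 4 * p).
have DE : D ^+ 2 = s ^+ 2 - 4 * p by rewrite sqrtCK.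
pose w1 := (s + D) / 2; pose w2 := (s - D) / 2.
have sE : s = w1 + w2 by rewrite /w1 /w2; field.
have pE : p = w1 * w2.
  have -> : w1 * w2 = (s ^+ 2 - D ^+ 2) / 4 by rewrite /w1 /w2; field.
  by rewrite DE; field.
have root (z : R[i]) : z ^+ 2 - s * z + p = 0 -> `|z| <= 1.
  move=> hz.
  have [r e] : exists r : R, `|z| = r%:C by rewrite normc_def; eexists.
  rewrite e lecR leNgt; apply/negP => r1'.
  have eq : (z - z1) * (z - z2) = - (z1 + z2 - s) * z + (z1 * z2 - p).
    rewrite -[RHS]addr0 -hz; ring.
  have g1 : (r - r1)%:C <= `|z - z1| by rewrite rmorphB/= -e -e1 lerB_dist.
  have g2 : (r - r2)%:C <= `|z - z2| by rewrite rmorphB/= -e -e2 lerB_dist.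
  have : (r - r1)%:C * (r - r2)%:C <= d%:C * r%:C + d%:C.
    apply: le_trans (_ : `|z - z1| * `|z - z2| <= _).
      by apply: ler_pM => //; rewrite ler0c subr_ge0 ltW//; apply: lt_trans r1'.
    rewrite -normrM eq; apply: le_trans (ler_normD _ _) _.
    apply: lerD; last exact: ltW.
    by rewrite normrM normrN -e ler_wpM2r// ltW.
  rewrite -!rmorphM/= -rmorphD/= lecR; apply/negP; rewrite -ltNge /d.
  have : (1 - r1) * r <= (r - r1) * 1 by nra.
  have : (1 - r1) * (1 - r2) * r <= (r - r1) * (r - r2).
    by rewrite mulrAC; apply: ler_pM; nra.
  have : 0 < (1 - r1) * (1 - r2) by rewrite mulr_gt0 ?subr_gt0.
  nra.
rewrite sE pE; apply: symm_Gamma; apply: root; rewrite sE pE; ring.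
Qed.

Lemma symmC (R : realType) (z1 z2 : R[i]^o) : symm z1 z2 = symm z2 z1.
Proof. by rewrite /symm addrC mulrC. Qed.

Lemma continuous_pairing (T U V : topologicalType) (f : T -> U) (g : T -> V) (x : T) :
  {for x, continuous f} -> {for x, continuous g} ->
  {for x, continuous (fun y => (f y, g y))}.
Proof. by move=> cf cg; exact: (cvg_pair cf cg). Qed.

Definition torus_image (R : realType) : set (R[i]^o * R[i]^o) :=
  [set w | exists z1 z2 : R[i], [/\ `|z1| = 1, `|z2| = 1 & w = symm z1 z2]].

Definition cis_symm (R : realType) (t : R * R) : R[i]^o * R[i]^o :=
  symm (cis t.1) (cis t.2).

Definition square (R : realType) : set (R * R) :=
  `[- pi, pi]%classic `*` `[- pi, pi]%classic.

Lemma compact_square (R : realType) : compact (@square R).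
Proof. by apply: compact_setX; exact: segment_compact. Qed.

Lemma torus_imageE (R : realType) : @torus_image R = @cis_symm R @` @square R.
Proof.
apply/seteqP; split => [w [z1 [z2 [h1 h2 ->]]]|_ [t _ <-]].
  have [t1 i1 ->] := cis_surj h1; have [t2 i2 ->] := cis_surj h2.
  by exists (t1, t2).
by exists (cis t.1), (cis t.2); rewrite !norm_cis.
Qed.

(** The radius is a variable of its own: joint continuity with the angles, together with compactness
    of the square of angles, makes the radial limit uniform. *)
Lemma continuous_scaled_cis_symm (R : realType) :
  continuous (fun u : (R * R) * R => symm (u.2%:C * cis u.1.1) (u.2%:C * cis u.1.2)).
Proof.
move=> u.
have c0 : {for u, continuous (fun u : (R * R) * R => u.2%:C : R[i]^o)}.
  apply: (@continuous_comp _ _ _ snd (fun x : R => x%:C : R[i]^o)).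
    exact: cvg_snd.
  exact: continuous_real_complex.
have c1 : {for u, continuous (fun u : (R * R) * R => cis u.1.1 : R[i]^o)}.
  apply: (@continuous_comp _ _ _ (fun u : (R * R) * R => u.1.1) (fun t : R => cis t : R[i]^o)).
    apply: (@continuous_comp _ _ _ fst fst); exact: cvg_fst.
  exact: continuous_cis.
have c2 : {for u, continuous (fun u : (R * R) * R => cis u.1.2 : R[i]^o)}.
  apply: (@continuous_comp _ _ _ (fun u : (R * R) * R => u.1.2) (fun t : R => cis t : R[i]^o)).
    by apply: (@continuous_comp _ _ _ fst snd); [exact: cvg_fst|exact: cvg_snd].
  exact: continuous_cis.
have d1 := continuousM c0 c1; have d2 := continuousM c0 c2.
exact: continuous_pairing (continuousD d1 d2) (continuousM d1 d2).
Qed.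

Lemma continuous_cis_symm (R : realType) : continuous (@cis_symm R).
Proof.
have -> : @cis_symm R = (fun u : (R * R) * R =>
    symm (u.2%:C * cis u.1.1) (u.2%:C * cis u.1.2)) \o (fun t => (t, 1)).
  by apply/funext => t; rewrite /cis_symm/= !mul1r.
move=> t; apply: continuous_comp; last exact: continuous_scaled_cis_symm.
by apply: continuous_pairing; [exact: cvg_id|exact: cvg_cst].
Qed.

(** Differentiability is available only inside [Gamma]. Dilation by [r < 1] brings the closed bidisc
    there, and the one-variable maximum principle is applied to each coordinate in turn. *)
Lemma polydisc_max (R : realType) (f : R[i]^o * R[i]^o -> R[i]^o) (r N : R) (a b : R[i]) :
  (forall w, (@Gamma R)° w -> differentiable f w) -> 0 <= r < 1 ->
  (forall z1 z2 : R[i], `|z1| = 1 -> `|z2| = 1 ->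
     `|f (symm (r%:C * z1) (r%:C * z2))| <= N%:C) ->
  `|a| < 1 -> `|b| < 1 -> `|f (symm (r%:C * a) (r%:C * b))| <= N%:C.
Proof.
move=> df /andP[r0 r1] hN a1 b1.
have rz (z : R[i]) : `|z| <= 1 -> `|r%:C * z| < 1.
  move=> z1; rewrite normrM ger0_norm ?ler0c//.
  by apply: le_lt_trans (ler_wpM2l _ z1) _; rewrite ?mulr1 ?ler0c// ltcR.
have dl (z w : R[i]) : `|z| <= 1 -> `|w| <= 1 ->
    derivable (fun z : R[i]^o => f (symm (r%:C * z) (r%:C * w)) : R[i]^o) z 1.
  move=> z1 w1; apply/derivable1_diffP.
  apply: (@differentiable_comp _ _ _ _ (fun z : R[i]^o => symm (r%:C * z) (r%:C * w)) f).
    apply: differentiable_pair; first by apply: ex_diff.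
    by apply: ex_diff.
  by apply: df; apply: symm_interior; exact: rz.
have dr (z w : R[i]) : `|z| <= 1 -> `|w| <= 1 ->
    derivable (fun w : R[i]^o => f (symm (r%:C * z) (r%:C * w)) : R[i]^o) w 1.
  move=> z1 w1; rewrite (_ : (fun _ => _) = (fun w => f (symm (r%:C * w) (r%:C * z)))).
    exact: dl.
  by apply/funext => x; rewrite symmC.
apply: (@max_modulus_disc _ (fun w : R[i]^o => f (symm (r%:C * a) (r%:C * w)))) => //.
  by move=> z z1; apply: dr => //; exact: ltW.
move=> z2 z21.
apply: (@max_modulus_disc _ (fun w : R[i]^o => f (symm (r%:C * w) (r%:C * z2)))) => //.
  by move=> z z1; apply: dl => //; rewrite z21.
by move=> z1 z11; exact: hN.
Qed.

Lemma torus_image_Gamma (R : realType) : @torus_image R `<=` @Gamma R.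
Proof. by move=> _ [z1 [z2 [h1 h2 ->]]]; apply: symm_Gamma; rewrite ?h1 ?h2. Qed.

Lemma Gamma_bound_of_torus (R : realType) (f : R[i]^o * R[i]^o -> R[i]^o) (M : R) :
  disc_algebra (@Gamma R) f -> (forall w, torus_image w -> `|f w| <= M%:C) ->
  forall w, Gamma w -> `|f w| <= M%:C.
Proof.
move=> [cf df] hM _ [[a b] /= [a1 b1] <-]; rewrite -/(symm a b).
have /subspace_continuousP cG := cf.
pose Psi (u : (R * R) * R) := symm (u.2%:C * cis u.1.1) (u.2%:C * cis u.1.2).
have PsiG (u : (R * R) * R) : 0 <= u.2 <= 1 -> Gamma (Psi u).
  move=> /andP[u0 u1]; apply: symm_Gamma;
    by rewrite normrM norm_cis mulr1 ger0_norm ?ler0c// lecR.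
apply/ler_addgt0Pr => _ /realC_gt0[e e0 ->].
have e20 : 0 < e / 2 by rewrite divr_gt0.
have e2C : 0 < (e / 2)%:C by rewrite ltcR.
(* Compactness lets one [r] serve all angles; near each angle the bound comes from continuity of [f]
   on [Gamma] at the corresponding torus point. *)
have torus_r : \forall r \near (1 : R)^'-, forall t, square t ->
    `|f (Psi (t, r))| <= (M + e / 2)%:C.
  have /compact_near_coveringP := @compact_square R.
  apply => t _.
  have GP : Gamma (Psi (t, 1)) by apply: PsiG; rewrite /= ler01 lexx.
  have /cvgrPdist_le /(_ _ e2C) := cG _ GP.
  rewrite near_withinE => hn.
  have : \forall u \near (t, 1 : R), Gamma (Psi u) ->
      `|f (Psi (t, 1)) - f (Psi u)| <= (e / 2)%:C.
    exact: (@continuous_scaled_cis_symm R (t, 1) _ hn).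
  move=> [[A B] /= [At B1] AB].
  exists (A, [set r | B r /\ 0 <= r <= 1]) => /=.
    split => //; near=> r; split; last first.
      apply/andP; split.
        by near: r; apply: nbhs_left_ge; exact: ltr01.
      by near: r; exact: nbhs_left_le.
    by near: r; apply: cvg_within.
  move=> [t' r] /= [At' [Br r01]].
  have := AB (t', r) (conj At' Br) (PsiG (t', r) r01) => h.
  have hT : `|f (Psi (t, 1))| <= M%:C.
    by apply: hM; exists (cis t.1), (cis t.2); rewrite !norm_cis /Psi !mul1r.
  rewrite rmorphD/=; apply: le_trans (lerD hT h).
  by rewrite -[X in `|X| <= _](subKr (f (Psi (t, 1)))); exact: ler_normB.
(* One factor [r] is the dilation in [polydisc_max]; the other moves [(a, b)], possibly on the
   boundary, into the open bidisc. *)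
have center : \forall r \near (1 : R)^'-,
    `|f (symm a b) - f (symm (r%:C * (r%:C * a)) (r%:C * (r%:C * b)))| <= (e / 2)%:C.
  have GP : Gamma (symm a b) by exact: symm_Gamma.
  have /cvgrPdist_le /(_ _ e2C) := cG _ GP.
  rewrite near_withinE => hn.
  have ct : {for 1 : R, continuous (fun r : R => symm (r%:C * (r%:C * a)) (r%:C * (r%:C * b)))}.
    have c0 := @continuous_real_complex R 1.
    have c1 (z : R[i]) : {for 1 : R, continuous (fun r : R => r%:C * (r%:C * z) : R[i]^o)}.
      by apply: (continuousM c0); apply: (continuousM c0); exact: cvg_cst.
    exact: continuous_pairing (continuousD (c1 a) (c1 b)) (continuousM (c1 a) (c1 b)).
  have ct' : (fun r : R => symm (r%:C * (r%:C * a)) (r%:C * (r%:C * b))) @ (1 : R) --> symm a b.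
    have -> : symm a b = symm ((1 : R)%:C * ((1 : R)%:C * a)) ((1 : R)%:C * ((1 : R)%:C * b)).
      by rewrite !mul1r.
    exact: ct.
  have : \forall r \near (1 : R), Gamma (symm (r%:C * (r%:C * a)) (r%:C * (r%:C * b))) ->
    `|f (symm a b) - f (symm (r%:C * (r%:C * a)) (r%:C * (r%:C * b)))| <= (e / 2)%:C.
    exact: (ct' _ hn).
  move=> /cvg_within h; near=> r.
  have : Gamma (symm (r%:C * (r%:C * a)) (r%:C * (r%:C * b))).
    have r0 : 0 <= r by near: r; apply: nbhs_left_ge; exact: ltr01.
    have r1 : r <= 1 by near: r; exact: nbhs_left_le.
    have rC : r%:C <= (1 : R)%:C by rewrite lecR.
    have rle (z : R[i]) : `|z| <= 1 -> `|r%:C * z| <= 1.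
      move=> z1; rewrite normrM ger0_norm ?ler0c//.
      by apply: mulr_ile1 => //; rewrite ler0c.
    by apply: symm_Gamma; exact: (rle _ (rle _ _)).
  near: r; exact: h.
near (1 : R)^'- => r.
have r0 : 0 <= r by near: r; apply: nbhs_left_ge; exact: ltr01.
have r1 : r < 1 by near: r; exact: nbhs_left_lt.
have ra (z : R[i]) : `|z| <= 1 -> `|r%:C * z| < 1.
  move=> z1; rewrite normrM ger0_norm ?ler0c//.
  by apply: le_lt_trans (ler_wpM2l _ z1) _; rewrite ?mulr1 ?ler0c// ltcR.
have h1 : `|f (symm (r%:C * (r%:C * a)) (r%:C * (r%:C * b)))| <= (M + e / 2)%:C.
  apply: polydisc_max; [exact: df|by rewrite r0| |exact: ra|exact: ra].
  move=> z1 z2 z11 z21.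
  have [t1 i1 ->] := cis_surj z11; have [t2 i2 ->] := cis_surj z21.
  have : forall t, square t -> `|f (Psi (t, r))| <= (M + e / 2)%:C by near: r.
  by move=> /(_ (t1, t2)); apply.
have h2 : `|f (symm a b) - f (symm (r%:C * (r%:C * a)) (r%:C * (r%:C * b)))| <= (e / 2)%:C.
  by near: r.
have -> : M%:C + e%:C = (e / 2)%:C + (M + e / 2)%:C by rewrite -!rmorphD/=; congr (_%:C); field.
apply: le_trans (lerD h2 h1).
by rewrite -[X in `|X| <= _](subrK (f (symm (r%:C * (r%:C * a)) (r%:C * (r%:C * b)))));
  exact: ler_normD.
Unshelve. all: by end_near.
Qed.

Lemma torus_closed_boundary (R : realType) : closed_boundary (@Gamma R) (@torus_image R).
Proof.
split; last 1 first.
- move=> f fA; have /subspace_continuousP cG := fA.1.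
  have cc : continuous (fun t : R * R => f (cis_symm t)).
    move=> t; have tG (u : R * R) : Gamma (cis_symm u).
      by apply: symm_Gamma; rewrite norm_cis.
    move=> W hW.
    have h : nbhs (cis_symm t) (fun x => Gamma x -> W (f x)) := cG _ (tG t) W hW.
    have := @continuous_cis_symm R t _ h; rewrite /= /nbhs/=.
    by apply: filterS => u /(_ (tG u)).
  have cr : continuous (fun t : R * R => Re `|f (cis_symm t)|).
    move=> t; apply: (@continuous_comp _ _ _ (fun t => `|f (cis_symm t)| : R[i]^o) (@complex.Re R)).
      apply: (@continuous_comp _ _ _ (fun t => f (cis_symm t)) (fun z : R[i]^o => `|z| : R[i]^o)).
        exact: cc.
      exact: norm_continuous.
    exact: continuous_Re.
  have [|c /set_mem cK hc] := @compact_EVT_max _ _ _ _ _ (@compact_square R)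
      (continuous_subspaceT cr).
    exists (0, 0); split; rewrite /= in_itv/= oppr_le0 pi_ge0//.
  have NE (z : R[i]) : `|z| = (Re `|z|)%:C by rewrite normc_def.
  exists (cis_symm c); first by rewrite torus_imageE; exists c.
  move=> z zG; rewrite [leRHS]NE; apply: Gamma_bound_of_torus fA _ _ zG.
  rewrite torus_imageE => _ [t tK <-]; rewrite NE lecR; apply: hc; exact: mem_set.
- rewrite torus_imageE; apply: compact_closed.
    exact: norm_hausdorff.
  apply: continuous_compact; last exact: compact_square.
  by apply: continuous_subspaceT; exact: continuous_cis_symm.
- exact: torus_image_Gamma.
Qed.

Lemma bGamma_torus (R : realType) : @bGamma R `<=` @torus_image R.
Proof. by move=> w; apply; exact: torus_closed_boundary. Qed.

(** * Peak functions at the points of the distinguished boundary *)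

Lemma peak_inequality (R : realType) (x1 y1 x2 y2 t : R) :
  x1 ^+ 2 + y1 ^+ 2 <= 1 -> x2 ^+ 2 + y2 ^+ 2 <= 1 -> -2 <= t <= 2 ->
  let A := 200 + 4 * (x1 * x2 - y1 * y2) - ((x1 + x2 - t) ^+ 2 - (y1 + y2) ^+ 2) in
  let B := 4 * (x1 * y2 + x2 * y1) - 2 * (x1 + x2 - t) * (y1 + y2) in
  204 ^+ 2 <= A ^+ 2 + B ^+ 2 ->
  [/\ x1 + x2 = t, y1 + y2 = 0, x1 * x2 - y1 * y2 = 1 & x1 * y2 + x2 * y1 = 0].
Proof.
move=> h1 h2 /andP[tl tr] A B.
set X := x1 - x2; set Y := y1 + y2; set Z := x1 + x2 - t.
set D := 2 * (1 - (x1 ^+ 2 + y1 ^+ 2)) + 2 * (1 - (x2 ^+ 2 + y2 ^+ 2)) +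
  2 * X ^+ 2 + Y ^+ 2 + Z ^+ 2.
have AE : A = 204 - D by rewrite /A /D /X /Y /Z; ring.
have BE : B = (4 * x1 - 2 * Z) * Y - 4 * y1 * X by rewrite /B /X /Y /Z; ring.
have X0 := sqr_ge0 X; have Y0 := sqr_ge0 Y; have Z0 := sqr_ge0 Z.
have unit_bound (u v : R) : u ^+ 2 + v ^+ 2 <= 1 -> -1 <= u <= 1.
  by have := sqr_ge0 v => ? ?; apply/andP; split; nra.
have /andP[x1l x1r] := unit_bound _ _ h1; have /andP[x2l x2r] := unit_bound _ _ h2.
have /andP[y1l y1r] : -1 <= y1 <= 1 by apply: (unit_bound _ x1); lra.
have /andP[y2l y2r] : -1 <= y2 <= 1 by apply: (unit_bound _ x2); lra.
have Xb : X ^+ 2 <= 4 by rewrite /X; nra.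
have Yb : Y ^+ 2 <= 4 by rewrite /Y; nra.
have Zb : Z ^+ 2 <= 16 by rewrite /Z; nra.
have D0 : 0 <= D by rewrite /D; lra.
have D32 : D <= 32.
  by rewrite /D; have := sqr_ge0 x1; have := sqr_ge0 y1;
    have := sqr_ge0 x2; have := sqr_ge0 y2; lra.
have Bb : B ^+ 2 <= 288 * D.
  have k1 : ((4 * x1 - 2 * Z) * Y) ^+ 2 <= 144 * Y ^+ 2.
    rewrite exprMn ler_wpM2r//.
    have : -12 <= 4 * x1 - 2 * Z <= 12 by rewrite /Z; lra.
    by move=> /andP[a b]; nra.
  have k2 : (4 * y1 * X) ^+ 2 <= 16 * X ^+ 2.
    by rewrite exprMn ler_wpM2r//; nra.
  rewrite BE; have := sqr_ge0 ((4 * x1 - 2 * Z) * Y + 4 * y1 * X).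
  by rewrite /D; lra.
(* The bound for [B] gives [A ^ 2 + B ^ 2 <= 204 ^ 2 - D (120 - D)], and [D <= 32] leaves only
   [D = 0]. *)
rewrite AE => h; have DE : D = 0 by nra.
have X0' : X = 0 by apply/eqP; rewrite -sqrf_eq0 eq_le X0 andbT; move: DE; rewrite /D; lra.
have Y0' : Y = 0 by apply/eqP; rewrite -sqrf_eq0 eq_le Y0 andbT; move: DE; rewrite /D; lra.
have Z0' : Z = 0 by apply/eqP; rewrite -sqrf_eq0 eq_le Z0 andbT; move: DE; rewrite /D; lra.
have e1 : x1 = x2 by move: X0'; rewrite /X; lra.
have e2 : y2 = - y1 by move: Y0'; rewrite /Y; lra.
have e3 : x1 ^+ 2 + y1 ^+ 2 = 1.
  by move: DE; rewrite /D X0' Y0' Z0' !expr0n/=; lra.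
split; [by move: Z0'; rewrite /Z; lra|exact: Y0'| |].
  by rewrite -e1 e2 -e3; ring.
by rewrite -e1 e2; ring.
Qed.

(* For [c = 1] the peak value 204 is attained only at [(t, 1)]: with
   [z_k = x_k + i y_k], the real part of [4 p - (s - t) ^ 2] is
   [4 - 2 (1 - |z_1| ^ 2) - 2 (1 - |z_2| ^ 2) - 2 (x_1 - x_2) ^ 2 - (y_1 + y_2) ^ 2
   - (x_1 + x_2 - t) ^ 2], and the square of its imaginary part is at most 288 times
   the defect from 4, which the constant 200 outweighs. *)
Definition peak (R : realType) (c t : R[i]) (w : R[i]^o * R[i]^o) : R[i]^o :=
  200 + 4 * (c ^+ 2 * w.2) - (c * w.1 - t) * (c * w.1 - t).

Lemma differentiable_peak (R : realType) (c t : R[i]) (w : R[i]^o * R[i]^o) :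
  differentiable (peak c t) w.
Proof.
have d1 : differentiable (fun w : R[i]^o * R[i]^o => w.1) w.
  by apply: linear_differentiable => ?; exact: cvg_fst.
have d2 : differentiable (fun w : R[i]^o * R[i]^o => w.2) w.
  by apply: linear_differentiable => ?; exact: cvg_snd.
have dc (a : R[i]^o) : differentiable (fun w : R[i]^o * R[i]^o => a) w.
  exact: differentiable_cst.
apply: differentiableB.
  apply: differentiableD; first exact: dc.
  by apply: differentiableM; [exact: dc|apply: differentiableM; [exact: dc|]].
have dt : differentiable (fun w : R[i]^o * R[i]^o => c * w.1 - t : R[i]^o) w.
  by apply: differentiableB; [apply: differentiableM; [exact: dc|]|exact: dc].
exact: differentiableM.
Qed.

(** With [c] a square root of [p], multiplying both coordinates of the bidisc by [conjc c] turns
    [(s, p)] into [(t0, 1)] with [t0] real in [[-2, 2]]. The rotated peak function attains its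
    maximum over [Gamma] only at [(s, p)], so every closed boundary contains this point. *)
Lemma bGamma_of_equations (R : realType) (s p : R[i]) :
  `|p| = 1 -> s = conjc s * p -> `|s| <= 2 -> @bGamma R (s, p).
Proof.
move=> p1 sE s2.
pose c := sqrtC p.
have cc : c ^+ 2 = p by rewrite sqrtCK.
have c1 : `|c| = 1 by apply/eqP; rewrite -(@eqrXn2 _ 2)// -normrX cc p1 expr1n.
have cJ : c * conjc c = 1 by rewrite -sqr_normc c1 expr1n.
have tE : conjc c * s = c * conjc s.
  rewrite {1}sE -cc; transitivity ((c * conjc c) * (c * conjc s)); first by ring.
  by rewrite cJ mul1r.
have [t0 tE0] : exists t0 : R, conjc c * s = t0%:C.
  have : conjc (conjc c * s) = conjc c * s by rewrite conjcM conjcK tE.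
  case: (conjc c * s) => a b [] h; exists a.
  by apply/eqP; rewrite eq_complex/= eqxx/=; apply/eqP; lra.
have sE0 : s = c * t0%:C by rewrite -tE0 mulrA cJ mul1r.
have t02 : -2 <= t0 <= 2.
  rewrite -ler_norml -lecR.
  have <- : `|s| = `|t0|%:C.
    by rewrite sE0 normrM c1 mul1r normc_def/= expr0n/= addr0 sqrtr_sqr.
  by rewrite (rmorph_nat (real_complex R) 2).
have normC_le (z : R[i]) : `|z| <= 1 -> Re z ^+ 2 + Im z ^+ 2 <= 1.
  move=> z1; rewrite -lecR add_Re2_Im2; apply: exprn_ile1 => //.
have spG : Gamma (s, p).
  pose h := Num.sqrt (1 - (t0 / 2) ^+ 2).
  have h2 : h ^+ 2 = 1 - (t0 / 2) ^+ 2 by rewrite sqr_sqrtr//; nra.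
  (* The unit number with [v + conjc v = t0], so that [c v] and [c conjc v] have sum [s] and product
     [p]. *)
  pose v : R[i] := (t0 / 2) +i* h.
  have vJ : v * conjc v = 1.
    apply/eqP; rewrite eq_complex/=; apply/andP; split; apply/eqP; last by ring.
    by rewrite mulrN opprK -!expr2 h2; ring.
  have vn : `|v| = 1 by apply/eqP; rewrite -(@eqrXn2 _ 2)// sqr_normc vJ expr1n.
  have -> : (s, p) = symm (c * v) (c * conjc v).
    congr (_, _).
      rewrite sE0 -mulrDr; congr (_ * _); apply/eqP; rewrite eq_complex/=.
      by apply/andP; split; apply/eqP; field.
    by rewrite mulrACA vJ mulr1 -expr2 cc.
  by apply: symm_Gamma; rewrite normrM c1 mul1r ?normcJ vn.
move=> F [cF FG hF].
pose f := peak (conjc c) t0%:C.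
have [|w wF hw] := hF f.
  split; last by move=> w _; exact: differentiable_peak.
  apply: continuous_subspaceT => w; apply: differentiable_continuous.
  exact: differentiable_peak.
suff -> : (s, p) = w by [].
have {}hw := hw _ spG.
have fsp : f (s, p) = 204.
  rewrite /f /peak/= tE0 subrr mulr0 subr0 -cc -exprMn [conjc c * c]mulrC cJ.
  by rewrite expr1n mulr1 -natrD.
move: hw; rewrite fsp.
have [[z1 z2] /= [z11 z21] wE] := FG _ wF.
have w1E : conjc c * w.1 = conjc c * z1 + conjc c * z2 by rewrite -wE /= mulrDr.
have w2E : (conjc c) ^+ 2 * w.2 = (conjc c * z1) * (conjc c * z2).
  by rewrite -wE /=; ring.
rewrite /f /peak w1E w2E.
have := normC_le (conjc c * z1); have := normC_le (conjc c * z2).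
rewrite !normrM normcJ c1 !mul1r => /(_ z21) + /(_ z11).
case E1 : (conjc c * z1) => [x1 y1]; case E2 : (conjc c * z2) => [x2 y2] /= b2 b1.
rewrite -(@ler_pXn2r _ 2) ?nnegrE// -[X in _ <= X]add_Re2_Im2.
set g := _ - _; have [AE BE] : Re g = 200 + 4 * (x1 * x2 - y1 * y2)
    - ((x1 + x2 - t0) ^+ 2 - (y1 + y2) ^+ 2) /\
  Im g = 4 * (x1 * y2 + x2 * y1) - 2 * (x1 + x2 - t0) * (y1 + y2).
  have n2 (n : nat) : n%:R = (n%:R : R) +i* 0 :> R[i] by rewrite -(rmorph_nat (real_complex R)).
  by rewrite /g !n2/=; split; ring.
have -> : `|204 : R[i]| ^+ 2 = (204 ^+ 2)%:C.
  by rewrite ger0_norm// rmorphXn/= rmorph_nat.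
rewrite lecR AE BE => hw.
have [e1 e2 e3 e4] := peak_inequality b1 b2 t02 hw.
have cI (z z' : R[i]) : conjc c * z = z' -> z = c * z'.
  by move=> <-; rewrite mulrA cJ mul1r.
apply/eqP; rewrite -pair_eqE/=; apply/andP; split; apply/eqP.
  rewrite (cI _ _ w1E) E1 E2 sE0; congr (_ * _).
  by apply/eqP; rewrite eq_complex/= e1 e2 !eqxx.
have -> : w.2 = c ^+ 2 * ((conjc c) ^+ 2 * w.2).
  by rewrite mulrA -exprMn cJ expr1n mul1r.
rewrite w2E E1 E2 cc -[LHS]mulr1; congr (_ * _).
by apply/eqP; rewrite eq_complex/= e3 [y1 * x2]mulrC e4 !eqxx.
Qed.

(** * Hilbert space operators *)

Lemma conjcN (R : rcfType) (x : R[i]) : conjc (- x) = - conjc x.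
Proof. exact: rmorphN. Qed.

Lemma realCM (R : rcfType) (x y : R) : (x * y)%:C = x%:C * y%:C.
Proof. exact: rmorphM. Qed.

Section HilbertBasics.
Context {R : realType} {H : hilbertSpace R}.
Implicit Types (x y z : H) (a b : R[i]).

(** Norms take values in [R[i]]; real-valued copies of them open the estimates to real
    arithmetic. *)
Definition cabs (a : R[i]) : R := Re `|a|.
Definition ip x y : R[i] := inner H x y.
Definition nrm x : R := Re `|x|.

Lemma cabsE a : `|a| = (cabs a)%:C.
Proof. by rewrite /cabs normc_def. Qed.

Lemma cabs_ge0 a : 0 <= cabs a.
Proof. by rewrite -ler0c -cabsE. Qed.

Lemma cabsM a b : cabs (a * b) = cabs a * cabs b.
Proof. by apply: (@complexI R); rewrite -cabsE rmorphM/= -!cabsE normrM. Qed.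

Lemma cabsD a b : cabs (a + b) <= cabs a + cabs b.
Proof. by rewrite -lecR rmorphD/= -!cabsE ler_normD. Qed.

Lemma cabs_real (r : R) : cabs r%:C = `|r|.
Proof. by rewrite /cabs normc_def/= expr0n/= addr0 sqrtr_sqr. Qed.

Lemma cabs_eq0 a : cabs a = 0 -> a = 0.
Proof. by move=> h; apply/eqP; rewrite -normr_eq0 cabsE h. Qed.

Lemma Re_le_cabs a : Re a <= cabs a.
Proof.
apply: le_trans (ler_norm _) _; rewrite -lecR -cabsE; exact: normc_ge_Re.
Qed.

Lemma mulCJ a : a * conjc a = (cabs a ^+ 2)%:C.
Proof. by rewrite -sqr_normc cabsE rmorphXn. Qed.

Lemma ipDl x y z : ip (x + y) z = ip x z + ip y z.
Proof. exact: linearDl. Qed.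

Lemma ipZl a x y : ip (a *: x) y = a * ip x y.
Proof. exact: linearZl_LR. Qed.

Lemma ipC x y : ip x y = conjc (ip y x).
Proof. by rewrite /ip hermC /= expr0 mul1r. Qed.

Lemma ipDr x y z : ip x (y + z) = ip x y + ip x z.
Proof. by rewrite ipC ipDl conjcD -!ipC. Qed.

Lemma ipZr a x y : ip x (a *: y) = conjc a * ip x y.
Proof. by rewrite ipC ipZl conjcM -ipC. Qed.

Lemma ipNl x y : ip (- x) y = - ip x y.
Proof. by rewrite -scaleN1r ipZl mulN1r. Qed.

Lemma ipNr x y : ip x (- y) = - ip x y.
Proof. by rewrite ipC ipNl conjcN -ipC. Qed.

Lemma ipBl x y z : ip (x - y) z = ip x z - ip y z.
Proof. by rewrite ipDl ipNl. Qed.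

Lemma ipBr x y z : ip x (y - z) = ip x y - ip x z.
Proof. by rewrite ipDr ipNr. Qed.

Lemma ip0l y : ip 0 y = 0.
Proof. by rewrite -(scale0r 0) ipZl mul0r. Qed.

Lemma ip0r y : ip y 0 = 0.
Proof. by rewrite ipC ip0l conjc0. Qed.

Lemma nrmE x : `|x| = (nrm x)%:C.
Proof.
have : 0 <= `|x| by [].
by rewrite /nrm; case: `|x| => u v; rewrite lecE/= => /andP[/eqP -> _].
Qed.

Lemma nrm_ge0 x : 0 <= nrm x.
Proof. by rewrite -ler0c -nrmE. Qed.

Lemma nrm0 : nrm 0 = 0.
Proof. by apply: (@complexI R); rewrite -nrmE normr0. Qed.

Lemma nrm_eq0 x : nrm x = 0 -> x = 0.
Proof. by move=> h; apply/eqP; rewrite -normr_eq0 nrmE h. Qed.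

Lemma nrmD x y : nrm (x + y) <= nrm x + nrm y.
Proof. by rewrite -lecR rmorphD/= -!nrmE ler_normD. Qed.

Lemma nrmN x : nrm (- x) = nrm x.
Proof. by rewrite /nrm normrN. Qed.

Lemma nrmB x y : nrm (x - y) <= nrm x + nrm y.
Proof. by rewrite -[nrm y]nrmN nrmD. Qed.

Lemma nrmZ a x : nrm (a *: x) = cabs a * nrm x.
Proof. by apply: (@complexI R); rewrite -nrmE normrZ rmorphM/= -nrmE -cabsE. Qed.

Lemma ipxx x : ip x x = (nrm x ^+ 2)%:C.
Proof. by rewrite /ip -inner_norm nrmE rmorphXn. Qed.

Lemma nrm_sqr x : nrm x ^+ 2 = Re (ip x x).
Proof. by rewrite ipxx. Qed.

Lemma ReipC x y : Re (ip x y) = Re (ip y x).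
Proof. by rewrite ipC; case: (ip y x). Qed.

Lemma nrmD_sqr x y : nrm (x + y) ^+ 2 = nrm x ^+ 2 + nrm y ^+ 2 + 2 * Re (ip x y).
Proof.
rewrite !nrm_sqr ipDl !ipDr !raddfD/= (ReipC y x); ring.
Qed.

Lemma nrmB_sqr x y : nrm (x - y) ^+ 2 = nrm x ^+ 2 + nrm y ^+ 2 - 2 * Re (ip x y).
Proof. by rewrite nrmD_sqr nrmN ipNr raddfN/=; ring. Qed.

Lemma cauchy_schwarz x y : cabs (ip x y) <= nrm x * nrm y.
Proof.
have [y0|y0] := eqVneq (nrm y) 0.
  by rewrite (nrm_eq0 y0) ip0r nrm0 mulr0 /cabs normr0.
have yp : 0 < nrm y by rewrite lt_def y0 nrm_ge0.
pose d := ip x y; pose k := (nrm y ^+ 2)^-1.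
have : 0 <= nrm (x - (d * k%:C) *: y) ^+ 2 by rewrite sqr_ge0.
rewrite nrmB_sqr nrmZ ipZr -/d cabsM cabs_real conjcM.
have -> : conjc d * conjc k%:C * d = (cabs d ^+ 2 * k)%:C.
  by rewrite conjc_real mulrAC [conjc d * d]mulrC mulCJ -realCM.
rewrite /= => h.
have ky : k * nrm y ^+ 2 = 1 by rewrite mulVf// expf_neq0.
have k0 : 0 < k by rewrite invr_gt0 exprn_gt0.
rewrite (ger0_norm (ltW k0)) in h.
have h2 : cabs d ^+ 2 * k <= nrm x ^+ 2.
  have e : (cabs d * k * nrm y) ^+ 2 = cabs d ^+ 2 * k.
    by transitivity (cabs d ^+ 2 * k * (k * nrm y ^+ 2)); [ring|rewrite ky mulr1].
  by rewrite e in h; lra.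
have d2 : cabs d ^+ 2 <= (nrm x * nrm y) ^+ 2.
  have := ler_wpM2r (sqr_ge0 (nrm y)) h2.
  by rewrite -mulrA ky mulr1 exprMn.
by rewrite -(@ler_pXn2r _ 2)// nnegrE ?cabs_ge0// mulr_ge0// nrm_ge0.
Qed.

Lemma Re_ip_le x y : Re (ip x y) <= nrm x * nrm y.
Proof. exact: le_trans (Re_le_cabs _) (cauchy_schwarz _ _). Qed.

Lemma eq_of_ip x y : (forall z, ip z x = ip z y) -> x = y.
Proof.
move=> h; apply/eqP; rewrite -subr_eq0; apply/eqP; apply: nrm_eq0.
by apply/eqP; rewrite -sqrf_eq0 nrm_sqr ipBr h subrr.
Qed.

Lemma complete_nrm (u : nat -> H) :
  (forall e : R, 0 < e -> exists N, forall n k, (N <= n)%N -> (N <= k)%N ->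
     nrm (u n - u k) <= e) ->
  exists l, forall e : R, 0 < e -> exists N, forall n, (N <= n)%N -> nrm (u n - l) <= e.
Proof.
move=> hu.
have /cauchy_cvg/cvg_ex[l hl] : cauchy (u @ \oo).
  apply: cauchy_exP => _ /realC_gt0[e e0 ->].
  have e20 : 0 < e / 2 by rewrite divr_gt0.
  have [N hN] := hu _ e20; exists (u N), N => // n /= Nn.
  rewrite -ball_normE/= nrmE ltcR; apply: le_lt_trans (hN _ _ (leqnn N) Nn) _.
  by rewrite ltr_pdivrMr// ltr_pMr// ltr1n.
exists l => e e0.
move/cvgrPdist_le : hl => /(_ e%:C); rewrite ltcR => /(_ e0)[N _ hN].
exists N => n /hN /=; rewrite distrC nrmE lecR.
exact.
Qed.

End HilbertBasics.

(** The first-order condition at a minimum. At [t = - s b] the quadratic term is at most half of the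
    linear one in size when [a] is positive. *)
Lemma linear_coef_eq0 (R : realFieldType) (a b : R) :
  (forall t : R, 0 <= t ^+ 2 * a + t * b) -> b = 0.
Proof.
move=> h; apply/eqP/negPn/negP => b0.
have b2 : 0 < b ^+ 2 by rewrite lt_def sqr_ge0 expf_neq0.
pose s := (2 * (`|a| + 1))^-1.
have s0 : 0 < s by rewrite invr_gt0 mulr_gt0// ltr_wpDl.
have sa : s * a <= 1 / 2.
  rewrite /s mulrC ler_pdivrMr ?mulr_gt0 ?ltr_wpDl//.
  by have := ler_norm a; lra.
have := h (- s * b); rewrite exprMn sqrrN.
have -> : s ^+ 2 * b ^+ 2 * a + - s * b * b = (s * b ^+ 2) * (s * a - 1) by ring.
by rewrite leNgt (pmulr_rlt0 _ (mulr_gt0 s0 b2)) => /negP; apply; lra.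
Qed.

Section Operators.
Context {R : realType} {H : hilbertSpace R}.
Implicit Types (x y z : H) (a b : R[i]) (T : H -> H).

Lemma linearopD T x y : linear T -> T (x + y) = T x + T y.
Proof. by move=> lT; have := lT 1 x y; rewrite !scale1r. Qed.

Lemma linearop0 T : linear T -> T 0 = 0.
Proof. by move=> lT; have := lT (-1) 0 0; rewrite !scaleN1r oppr0 add0r addNr. Qed.

Lemma linearopZ T a x : linear T -> T (a *: x) = a *: T x.
Proof. by move=> lT; have := lT a x 0; rewrite (linearop0 lT) !addr0. Qed.

Lemma linearopB T x y : linear T -> T (x - y) = T x - T y.
Proof.
by move=> lT; rewrite -scaleN1r linearopD// linearopZ// scaleN1r.
Qed.

(** The energy [J] is bounded below by coercivity, its minimizing sequences are Cauchy, and its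
    derivative vanishes at the limit. With [Z] the identity this is the Riesz theorem, from which
    adjoints are obtained; with [Z = A'A + B'B] it gives surjectivity of [Z]. *)
Lemma lax_milgram (Z : H -> H) (phi : H -> R[i]) (M c N : R) :
  linear Z -> 0 <= M -> (forall x, nrm (Z x) <= M * nrm x) ->
  (forall x y, ip (Z x) y = ip x (Z y)) ->
  0 < c -> (forall x, c * nrm x ^+ 2 <= Re (ip (Z x) x)) ->
  (forall a x y, phi (a *: x + y) = a * phi x + phi y) ->
  0 <= N -> (forall x, cabs (phi x) <= N * nrm x) ->
  exists u, forall x, phi x = ip (Z x) u.
Proof.
move=> lZ M0 bZ sZ c0 cZ lphi N0 bphi.
pose q x := Re (ip (Z x) x); pose J x := q x - 2 * Re (phi x).
have phiD x y : phi (x + y) = phi x + phi y.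
  by have := lphi 1 x y; rewrite scale1r mul1r.
have phiZ a x : phi (a *: x) = a * phi x.
  have p0 : phi 0 = 0.
    by have := lphi (-1) 0 0; rewrite scaleN1r oppr0 add0r mulN1r addNr.
  by have := lphi a x 0; rewrite !addr0 p0 addr0.
have q0 x : 0 <= q x by apply: le_trans (cZ x); rewrite mulr_ge0 ?sqr_ge0// ltW.
have JD x y : J (x + y) = J x + q y + 2 * (Re (ip (Z x) y) - Re (phi y)).
  rewrite /J /q (linearopD _ _ lZ) ipDl !ipDr !raddfD/= phiD raddfD/=.
  by rewrite (sZ y x) (ReipC y); ring.
have qZ (t : R) x : q (t%:C *: x) = t ^+ 2 * q x.
  rewrite /q (linearopZ _ _ lZ) ipZl ipZr conjc_real mulrA -realCM.
  by case: (ip _ _) => u v /=; ring.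
have ReZ (t : R) (a : R[i]) : Re (t%:C * a) = t * Re a by case: a => u v /=; ring.
have JN x y : J (x - y) = J x + q y - 2 * (Re (ip (Z x) y) - Re (phi y)).
  have -> : - y = (-1)%:C *: y by rewrite rmorphN1 scaleN1r.
  by rewrite JD qZ ipZr phiZ conjc_real !ReZ; ring.
have Jlow x : - (N ^+ 2 / c) <= J x.
  have h1 := cZ x; have h2 := le_trans (Re_le_cabs (phi x)) (bphi x).
  have : 0 <= c * (nrm x - N / c) ^+ 2 by rewrite mulr_ge0 ?sqr_ge0// ltW.
  have -> : c * (nrm x - N / c) ^+ 2 = c * nrm x ^+ 2 - 2 * (N * nrm x) + N ^+ 2 / c.
    by field; rewrite gt_eqF.
  by rewrite /J -/(q x) in h1 *; lra.
have hi : has_inf (range J).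
  split; first by exists (J 0), 0.
  by exists (- (N ^+ 2 / c)) => _ [x _ <-].
set m := inf (range J).
have mle x : m <= J x by apply: ge_inf; [exact: hi.2|exists x].
have near_min (n : nat) : exists x, J x < m + n.+1%:R^-1.
  have e0 : (0 : R) < n.+1%:R^-1 by rewrite invr_gt0.
  by have [_ [x _ <-] h] := inf_adherent e0 hi; exists x.
have [u hu] := choice near_min.
(* The parallelogram identity: [J (w + h) + J (w - h) = 2 J w + 2 q h] with [w] the midpoint and [h]
   the half difference, while [J w] is at least the infimum. *)
have gap n k : c * nrm (u n - u k) ^+ 2 <= 2 * (n.+1%:R^-1 + k.+1%:R^-1).
  pose w := (2^-1)%:C *: (u n + u k); pose h := (2^-1)%:C *: (u n - u k).
  have half : (2^-1)%:C + (2^-1)%:C = 1 :> R[i] by rewrite -rmorphD/=; congr (_%:C); field.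
  have e1 : u n = w + h.
    rewrite /w /h -scalerDr addrACA subrr addr0 scalerDr -scalerDl half scale1r//.
  have e2 : u k = w - h.
    rewrite /w /h -scalerBr opprB [u k - _]addrC addrACA subrr add0r.
    by rewrite scalerDr -scalerDl half scale1r.
  have hq : q h = 2^-1 ^+ 2 * q (u n - u k) by rewrite /h qZ.
  have := hu n; have := hu k; have := mle w; have := cZ (u n - u k).
  rewrite -/(q (u n - u k)) => h1 h2 h3 h4.
  have j1 := JD w h; have j2 := JN w h; rewrite -e1 hq in j1; rewrite -e2 hq in j2.
  have e4 : (2^-1 : R) ^+ 2 * 4 = 1 by field.
  have : q (u n - u k) = (2^-1 ^+ 2 * q (u n - u k)) * 4 by rewrite mulrAC e4 mul1r.
  move: h3 h4; move: n.+1%:R^-1 k.+1%:R^-1 => d1 d2; lra.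
have smallinv (e : R) : 0 < e -> exists n0, forall n, (n0 <= n)%N -> n.+1%:R^-1 <= e.
  move=> e0; exists (Num.truncn e^-1) => n hn.
  rewrite -[leRHS]invrK lef_pV2 ?posrE ?invr_gt0//.
  by apply: le_trans (ltW (truncnS_gt _)) _; rewrite ler_nat.
have [|l hl] := @complete_nrm _ _ u.
  move=> e e0.
  have [|n0 hn0] := smallinv (c * e ^+ 2 / 4).
    by rewrite divr_gt0// mulr_gt0// exprn_gt0.
  exists n0 => n k hn hk; have := gap n k; have := hn0 n hn; have := hn0 k hk => h1 h2 h3.
  have : c * nrm (u n - u k) ^+ 2 <= c * e ^+ 2.
    by move: h1 h2 h3; move: n.+1%:R^-1 k.+1%:R^-1 => d1 d2; lra.
  by rewrite ler_pM2l// ler_pXn2r// nnegrE ?nrm_ge0// ltW.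
have Jl : J l <= m.
  apply/ler_addgt0Pr => e e0.
  pose K := 2 * (M * nrm l + N) + 1.
  have K0 : 0 < K.
    by rewrite ltr_wpDl// mulr_ge0// addr_ge0 ?(ltW N0)// mulr_ge0// nrm_ge0.
  have e1 : 0 < e / 2 by rewrite divr_gt0.
  have [n0 hn0] := smallinv _ e1.
  have [|n1 hn1] := hl (e / 2 / K); first by rewrite divr_gt0.
  pose n := maxn n0 n1; have := hn0 n (leq_maxl _ _); have := hn1 n (leq_maxr _ _).
  have := hu n; rewrite -[u n in X in X -> _](subrK l) [_ - l + l]addrC JD.
  set h := u n - l => h1 h2 h3; rewrite ler_pdivlMr// in h2.
  have := q0 h; have := nrm_ge0 h; have := Re_ip_le (- Z l) h.
  rewrite ipNl raddfN/= nrmN; have := ler_wpM2r (nrm_ge0 h) (bZ l).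
  have := le_trans (Re_le_cabs _) (bphi h).
  by rewrite /K in h2; move: h1 h3; move: n.+1%:R^-1 => d1; lra.
have Re_eq x : Re (phi x) = Re (ip (Z x) l).
  have /eqP : 2 * (Re (ip (Z l) x) - Re (phi x)) = 0.
    apply: (@linear_coef_eq0 _ (q x)) => t.
    have := le_trans Jl (mle (l + t%:C *: x)).
    by rewrite JD qZ ipZr phiZ conjc_real !ReZ; lra.
  rewrite mulf_eq0 pnatr_eq0/= subr_eq0 => /eqP <-.
  by rewrite sZ ReipC.
(* Equality of real parts at [x] and at ['i *: x] gives both components. *)
exists l => x; have := Re_eq x; have := Re_eq ('i%C *: x).
rewrite phiZ (linearopZ _ _ lZ) ipZl.
case: (phi x) (ip _ _) => [a b] [a' b'] /= e1 e2.
by apply/eqP; rewrite eq_complex/=; apply/andP; split; apply/eqP; lra.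
Qed.

End Operators.

Section Adjoints.
Context {R : realType} {H : hilbertSpace R}.
Implicit Types (x y z : H) (a : R[i]) (T : H -> H).

(** A symmetric relation instead of the chosen [adjoint]: either map may be taken as the adjoint of
    the other, and linearity of both follows. *)
Definition adjoint_pair (T T' : H -> H) := forall x y, ip (T x) y = ip x (T' y).

Definition norm_bound (T : H -> H) (M : R) := forall x, nrm (T x) <= M * nrm x.

Lemma adjoint_pairC T T' : adjoint_pair T T' -> adjoint_pair T' T.
Proof. by move=> h x y; rewrite ipC -h -ipC. Qed.

Lemma adjoint_pair_linear T T' : adjoint_pair T T' -> linear T'.
Proof.
move=> h a x y; apply: eq_of_ip => z.
by rewrite ipDr ipZr -!h ipDr ipZr.
Qed.

Lemma adjoint_pair_bound T T' M : 0 <= M ->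
  adjoint_pair T T' -> norm_bound T M -> norm_bound T' M.
Proof.
move=> M0 h bT y.
have := nrm_ge0 (T' y); rewrite le_eqVlt => /orP[/eqP <-|t0].
  by rewrite mulr_ge0// nrm_ge0.
rewrite -(ler_pM2r t0) -expr2 nrm_sqr -h.
apply: le_trans (Re_ip_le _ _) _.
by apply: le_trans (ler_wpM2r (nrm_ge0 y) (bT _)) _; rewrite mulrAC.
Qed.

Lemma bounded_operatorP T : bounded_operator T ->
  linear T /\ exists2 M : R, 0 <= M & norm_bound T M.
Proof.
move=> [lT [M hM]]; split=> //; exists `|M| => // x.
have := hM x; rewrite !nrmE -realCM lecR => /le_trans; apply.
by rewrite ler_wpM2r ?nrm_ge0// ler_norm.
Qed.

Lemma bounded_operatorI T (M : R) : linear T -> norm_bound T M -> bounded_operator T.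
Proof. by move=> lT bT; split=> //; exists M => x; rewrite !nrmE -realCM lecR. Qed.

Lemma adjoint_unique T T' : adjoint_pair T T' -> adjoint T = T'.
Proof.
move=> h; apply: xget_unique => // U hU; apply/funext => y.
by apply: eq_of_ip => z; rewrite -h; exact/esym/hU.
Qed.

Lemma adjointP T : bounded_operator T -> adjoint_pair T (adjoint T).
Proof.
move=> /bounded_operatorP[lT [M M0 bT]].
have riesz y : exists u, forall x, ip (T x) y = ip x u.
  apply: (@lax_milgram R H id (fun x => ip (T x) y) 1 1 (M * nrm y)) => //.
  - by move=> x; rewrite mul1r.
  - by move=> x; rewrite mul1r nrm_sqr.
  - by move=> a x z; rewrite lT ipDl ipZl.
  - by rewrite mulr_ge0// nrm_ge0.
  - move=> x; apply: le_trans (cauchy_schwarz _ _) _.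
    by rewrite mulrAC ler_wpM2r ?nrm_ge0.
have [T' hT'] := choice riesz.
have h : adjoint_pair T T' by move=> x y; exact: hT'.
by rewrite (adjoint_unique h).
Qed.

End Adjoints.

(** * Approximate eigenvalues of selfadjoint operators *)

Section ApproximateSpectrum.
Context {R : realType} {H : hilbertSpace R}.
Implicit Types (x y z : H) (a : R[i]) (T A : H -> H) (b : H -> R).

Definition is_seminorm b :=
  (forall x y, b (x + y) <= b x + b y) /\ forall a x, b (a *: x) = cabs a * b x.

(** For [b x = nrm (T x - a *: x)] this says that [a] is an approximate eigenvalue of [T]; sums of
    such seminorms express joint ones. Failure of degeneracy is a lower bound for [b]. *)
Definition degenerate b :=
  forall e : R, 0 < e -> exists2 x : H, 0 < nrm x & b x <= e * nrm x.

Lemma seminorm_ge0 b x : is_seminorm b -> 0 <= b x.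
Proof.
move=> [bD bZ]; have := bD x (-1 *: x); rewrite scaleN1r subrr.
have -> : b 0 = 0 by have := bZ 0 0; rewrite scale0r /cabs normr0 mul0r.
rewrite -scaleN1r bZ /cabs normrN1 /= mul1r; lra.
Qed.

Lemma seminormD b1 b2 : is_seminorm b1 -> is_seminorm b2 ->
  is_seminorm (fun x => b1 x + b2 x).
Proof.
move=> [d1 z1] [d2 z2]; split=> [x y|a x]; last by rewrite z1 z2 mulrDr.
by rewrite addrACA lerD.
Qed.

Lemma seminorm0 : is_seminorm (fun _ => 0).
Proof. by split=> *; rewrite ?addr0 ?mulr0. Qed.

Lemma seminorm_op T : linear T -> is_seminorm (fun x => nrm (T x)).
Proof.
move=> lT; split=> [x y|a x]; first by rewrite linearopD// nrmD.
by rewrite (linearopZ _ _ lT) nrmZ.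
Qed.

Lemma linear_shift T a : linear T -> linear (fun x => T x - a *: x).
Proof.
move=> lT c x y; rewrite lT scalerDr opprD addrACA scalerBr; congr (_ - _ + _).
by rewrite !scalerA mulrC.
Qed.

(* [r] is the largest norm of [A] on the directions where [b] nearly vanishes;
   there [A ^ 2 - r ^ 2] is nearly zero, and one of its factors [A - r], [A + r]
   inherits this. *)
Lemma degenerate_selfadjoint b A (M K : R) :
  is_seminorm b -> degenerate b -> adjoint_pair A A ->
  0 <= M -> norm_bound A M -> 0 <= K -> (forall x, b (A x) <= K * b x) ->
  exists r : R, degenerate (fun x => b x + nrm (A x - r%:C *: x)) /\
    forall c, (forall e, 0 < e -> exists x,
      [/\ 0 < nrm x, b x <= e * nrm x & c * nrm x <= nrm (A x)]) -> c <= `|r|.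
Proof.
move=> sb db sA M0 bA K0 bK.
have lA : linear A by exact: adjoint_pair_linear sA.
pose S : set R := [set c | forall e, 0 < e -> exists x,
      [/\ 0 < nrm x, b x <= e * nrm x & c * nrm x <= nrm (A x)]].
have S0 : S 0.
  by move=> e e0; have [x x0 hx] := db e e0; exists x; rewrite mul0r nrm_ge0.
have hS : has_sup S.
  split; first by exists 0.
  exists M => c /(_ 1 ltr01)[x [x0 _ hx]].
  by rewrite -(ler_pM2r x0); exact: le_trans (bA x).
pose r := sup S.
have r0 : 0 <= r by exact: sup_upper_bound.
have above (e : R) : 0 < e -> exists2 d, 0 < d & forall x, 0 < nrm x ->
    b x <= d * nrm x -> nrm (A x) <= (r + e) * nrm x.
  move=> e0; apply: contrapT => hn.
  have : S (r + e).
    move=> d d0; apply: contrapT => hd; apply: hn; exists d => // x x0 bx.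
    rewrite leNgt; apply/negP => h; apply: hd; exists x; split=> //; exact: ltW.
  by move=> /(sup_upper_bound hS); rewrite -/r; lra.
have below (e d : R) : 0 < e -> 0 < d -> exists x,
    [/\ 0 < nrm x, b x <= d * nrm x & (r - e) * nrm x <= nrm (A x)].
  move=> e0 d0; have [c Sc rc] := sup_adherent e0 hS.
  have [x [x0 bx hx]] := Sc d d0; exists x; split=> //.
  by apply: le_trans hx; rewrite ler_wpM2r ?nrm_ge0// ltW.
(* Where [nrm (A x)] is nearly [r * nrm x] and [nrm (A (A x))] at most about [r * nrm (A x)],
   expanding the squared norm of [A (A x) - r ^ 2 x] makes it small. *)
have key (e : R) : 0 < e -> exists x, [/\ 0 < nrm x, b x <= e * nrm x &
    nrm (A (A x) - (r ^+ 2)%:C *: x) <= e * nrm x].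
  move=> e0; have [rz|rn] := eqVneq r 0.
    have e'0 : 0 < e / (M + 1) by rewrite divr_gt0// ltr_wpDl.
    have [d d0 hd] := above _ e'0.
    have [|x x0 bx] := db (Num.min e d); first by rewrite lt_min e0.
    exists x; split=> //.
      by apply: le_trans bx _; rewrite ler_wpM2r ?nrm_ge0// ge_min lexx.
    rewrite rz expr0n/= scale0r subr0.
    have := hd x x0; rewrite rz add0r => h.
    have {}h : nrm (A x) <= e / (M + 1) * nrm x.
      by apply: h; apply: le_trans bx _; rewrite ler_wpM2r ?nrm_ge0// ge_min lexx orbT.
    apply: le_trans (bA _) _; apply: le_trans (ler_wpM2l M0 h) _.
    rewrite mulrA ler_wpM2r ?nrm_ge0// mulrCA -[leRHS]mulr1 ler_wpM2l ?(ltW e0)//.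
    by rewrite ler_pdivrMr ?mul1r ?lerDl// ltr_wpDl.
  have rp : 0 < r by rewrite lt_def rn.
  (* [C t] bounds the squared norm of [A (A x) - r ^ 2 x] relative to that of [x]; see [s4]. *)
  pose C := 2 * r ^+ 3 + (2 * r + 1) * (r + 1) ^+ 2.
  have C0 : 0 < C.
    rewrite addr_gt0 ?mulr_gt0 ?exprn_gt0 ?addr_gt0 ?mulr_gt0//.
  pose t := Num.min (Num.min 1 (r / 2)) (e ^+ 2 / C).
  have t0 : 0 < t by rewrite !lt_min ltr01 !divr_gt0// exprn_gt0.
  have t1 : t <= 1 by rewrite /t !ge_min lexx.
  have tr : t <= r / 2 by rewrite /t !ge_min lexx orbT.
  have tC : C * t <= e ^+ 2.
    have : t <= e ^+ 2 / C by rewrite /t ge_min lexx orbT.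
    by rewrite ler_pdivlMr// mulrC.
  clearbody t.
  have [d d0 hd] := above _ t0.
  have K1 : 0 < K + 1 by rewrite ltr_wpDl.
  (* So small that [A x] is again a direction to which [hd] applies: [b (A x) <= K h nrm x <= d (r /
     2) nrm x <= d nrm (A x)]. *)
  pose h := Num.min (Num.min e d) (d * (r / 2) / (K + 1)).
  have h0 : 0 < h by rewrite /h !lt_min e0 d0 divr_gt0// mulr_gt0// divr_gt0.
  have he : h <= e by rewrite /h !ge_min lexx.
  have hdd : h <= d by rewrite /h !ge_min lexx orbT.
  have hK : K * h <= d * (r / 2).
    have : h <= d * (r / 2) / (K + 1) by rewrite /h ge_min lexx orbT.
    rewrite ler_pdivlMr// mulrDr mulr1 mulrC => hh.
    by apply: le_trans hh; rewrite lerDl ltW.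
  clearbody h.
  have [x [x0 bx hx]] := below _ _ t0 h0.
  have rx := mulr_ge0 (ltW rp) (ltW x0).
  have Yl : r / 2 * nrm x <= nrm (A x).
    by apply: le_trans hx; rewrite ler_wpM2r ?(ltW x0)//; lra.
  have Y0 : 0 < nrm (A x) by apply: lt_le_trans Yl; rewrite mulr_gt0// divr_gt0.
  have Yu : nrm (A x) <= (r + t) * nrm x.
    by apply: hd => //; apply: le_trans bx _; rewrite ler_wpM2r// ltW.
  have AYu : nrm (A (A x)) <= (r + t) * nrm (A x).
    apply: hd => //; apply: le_trans (bK x) _.
    apply: le_trans (ler_wpM2l K0 bx) _; rewrite mulrA.
    apply: le_trans (ler_wpM2r (ltW x0) hK) _.
    by rewrite -mulrA ler_wpM2l// ltW.
  exists x; split=> //; first by apply: le_trans bx _; rewrite ler_wpM2r// ltW.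
  rewrite -(@ler_pXn2r _ 2) ?nnegrE ?nrm_ge0 ?mulr_ge0 ?(ltW e0) ?(ltW x0)//.
  rewrite nrmB_sqr nrmZ cabs_real ipZr conjc_real sA.
  have -> : Re ((r ^+ 2)%:C * ip (A x) (A x)) = r ^+ 2 * nrm (A x) ^+ 2.
    by rewrite ipxx -realCM.
  rewrite ger0_norm ?sqr_ge0//.
  have q1 : nrm (A (A x)) ^+ 2 <= ((r + t) * nrm (A x)) ^+ 2.
    by rewrite ler_pXn2r ?nnegrE ?nrm_ge0// mulr_ge0 ?nrm_ge0//; lra.
  have q2 : nrm (A x) ^+ 2 <= ((r + t) * nrm x) ^+ 2.
    by rewrite ler_pXn2r ?nnegrE ?nrm_ge0// mulr_ge0 ?nrm_ge0//; lra.
  have q3 : ((r - t) * nrm x) ^+ 2 <= nrm (A x) ^+ 2.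
    by rewrite ler_pXn2r ?nnegrE ?nrm_ge0// mulr_ge0 ?nrm_ge0//; lra.
  rewrite !exprMn in q1 q2 q3 *.
  set n2 := nrm x ^+ 2 in q2 q3 *; set Y2 := nrm (A x) ^+ 2 in q1 q2 q3 *.
  have n20 : 0 <= n2 by exact: sqr_ge0.
  have s1 : (2 * r * t + t ^+ 2) * Y2 <= (2 * r * t + t ^+ 2) * ((r + t) ^+ 2 * n2).
    by rewrite ler_wpM2l// addr_ge0 ?sqr_ge0// !mulr_ge0// ltW.
  have s2 : r ^+ 2 * ((r - t) ^+ 2 * n2) <= r ^+ 2 * Y2 by rewrite ler_wpM2l// sqr_ge0.
  have s3 : C * t * n2 <= e ^+ 2 * n2 by rewrite ler_wpM2r.
  have s4 : (2 * r * t + t ^+ 2) * (r + t) ^+ 2 - r ^+ 2 * (r - t) ^+ 2 + r ^+ 4 <= C * t.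
    have -> : (2 * r * t + t ^+ 2) * (r + t) ^+ 2 - r ^+ 2 * (r - t) ^+ 2 + r ^+ 4 =
      (2 * r + t) * (r + t) ^+ 2 * t + 2 * r ^+ 3 * t - r ^+ 2 * t ^+ 2 by ring.
    have g1 : (2 * r + t) * (r + t) ^+ 2 <= (2 * r + 1) * (r + 1) ^+ 2.
      apply: ler_pM; rewrite ?sqr_ge0//; [lra|lra|].
      by rewrite ler_pXn2r ?nnegrE ?lerD2l// addr_ge0// ltW.
    have := ler_wpM2r (ltW t0) g1; have := mulr_ge0 (sqr_ge0 r) (sqr_ge0 t).
    by rewrite /C; lra.
  have s5 := ler_wpM2r n20 s4.
  by lra.
pose z x := A x + r%:C *: x.
have zE x : A (z x) - r%:C *: z x = A (A x) - (r ^+ 2)%:C *: x.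
  rewrite /z linearopD// (linearopZ _ _ lA) scalerDr scalerA opprD addrA addrK.
  by rewrite -realCM expr2.
have r_max c : S c -> c <= r by exact: sup_upper_bound.
(* If [- r] fails, [z x = A x + r x] is bounded below where [b] is small. Since [A - r] maps it to
   the small vector of [key], the vectors [z x] are witnesses for [r]. *)
have [dN|ndN] := pselect (degenerate (fun x => b x + nrm (A x - (- r)%:C *: x))).
  by exists (- r); rewrite normrN ger0_norm.
exists r; rewrite ger0_norm//; split=> // e e0.
have [d d0 hd] : exists2 d, 0 < d & forall x, 0 < nrm x -> b x <= d * nrm x ->
    d * nrm x <= nrm (z x).
  apply: contrapT => hn; apply: ndN => d d0; apply: contrapT => hd; apply: hn.
  exists (d / 2); first by rewrite divr_gt0.
  move=> x x0 bx; rewrite leNgt; apply/negP => h; apply: hd; exists x => //.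
  by rewrite rmorphN scaleNr opprK -/(z x); lra.
pose h := Num.min d (d * e / (K + r + 1)).
have Kr : 0 < K + r + 1 by rewrite ltr_wpDl// addr_ge0.
have h0 : 0 < h by rewrite lt_min d0 divr_gt0// mulr_gt0.
have hdd : h <= d by rewrite /h !ge_min lexx.
have hK : (K + r + 1) * h <= d * e.
  have : h <= d * e / (K + r + 1) by rewrite /h ge_min lexx orbT.
  by rewrite ler_pdivlMr// mulrC.
clearbody h.
have [x [x0 bx hx]] := key h h0.
have zx : d * nrm x <= nrm (z x).
  by apply: hd => //; apply: le_trans bx _; rewrite ler_wpM2r// ltW.
exists (z x); first by apply: lt_le_trans zx; rewrite mulr_gt0.
rewrite zE; have bz : b (z x) <= (K + r) * (h * nrm x).
  apply: le_trans (sb.1 _ _) _; rewrite sb.2 cabs_real ger0_norm// mulrDl.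
  apply: lerD; last by rewrite ler_wpM2l.
  by apply: le_trans (bK x) _; rewrite ler_wpM2l.
have := ler_wpM2r (ltW x0) hK; have := ler_wpM2l (ltW e0) zx.
by lra.
Qed.

End ApproximateSpectrum.

(** * Normal operators and the Koszul complex *)

Section Normal.
Context {R : realType} {H : hilbertSpace R}.
Implicit Types (x y z : H) (a s : R[i]) (T A B : H -> H) (b : H -> R).

Lemma degenerate_le b b' (K : R) : (forall x, b' x <= K * b x) -> 0 <= K ->
  degenerate b -> degenerate b'.
Proof.
move=> h K0 db e e0; have K1 : 0 < K + 1 by rewrite ltr_wpDl.
have [|x x0 hx] := db (e / (K + 1)); first by rewrite divr_gt0.
exists x => //; apply: le_trans (h x) _; apply: le_trans (ler_wpM2l K0 hx) _.
rewrite mulrA ler_wpM2r ?(ltW x0)// mulrCA -[leRHS]mulr1 ler_wpM2l ?(ltW e0)//.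
by rewrite ler_pdivrMr// mul1r lerDl.
Qed.

Lemma nrm_normal T T' x : adjoint_pair T T' -> (forall x, T (T' x) = T' (T x)) ->
  nrm (T' x) = nrm (T x).
Proof.
move=> h c; apply/eqP; rewrite -(@eqrXn2 _ 2) ?nrm_ge0// !nrm_sqr h.
by rewrite (adjoint_pairC h) c.
Qed.

Lemma adjoint_pair_shift T T' a : adjoint_pair T T' ->
  adjoint_pair (fun x => T x - a *: x) (fun x => T' x - conjc a *: x).
Proof. by move=> h x y; rewrite ipBl ipBr ipZl ipZr conjcK h. Qed.

Lemma commute_shift T T' a c : linear T -> linear T' -> (forall x, T (T' x) = T' (T x)) ->
  forall x, T (T' x - c *: x) - a *: (T' x - c *: x) =
    T' (T x - a *: x) - c *: (T x - a *: x).
Proof.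
move=> lT lT' cT x.
rewrite (linearopB _ _ lT) (linearopB _ _ lT') (linearopZ _ _ lT) (linearopZ _ _ lT').
rewrite cT !scalerBr !opprB !scalerA [c * a]mulrC addrACA [RHS]addrACA.
by congr (_ + _); rewrite addrC.
Qed.

(** The real part [A1] and the imaginary part [A2] commute by normality, so [A2] preserves the
    directions where both [b] and [A1 - r1] nearly vanish, and the selfadjoint case applies
    twice. *)
Lemma degenerate_normal b N N' (M K : R) :
  is_seminorm b -> degenerate b -> adjoint_pair N N' ->
  (forall x, N (N' x) = N' (N x)) -> 0 <= M -> norm_bound N M -> 0 <= K ->
  (forall x, b (N x) <= K * b x) -> (forall x, b (N' x) <= K * b x) ->
  exists s, degenerate (fun x => b x + nrm (N x - s *: x)).
Proof.
move=> sb db hN cN M0 bN K0 bK bK'.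
have lN' := adjoint_pair_linear hN; have hN' := adjoint_pairC hN.
have lN := adjoint_pair_linear hN'; have bN' := adjoint_pair_bound M0 hN bN.
pose h : R[i] := (2^-1)%:C; pose k : R[i] := 0 -i* 2^-1.
have hh : h + h = 1 by rewrite -rmorphD/=; congr (_%:C); field.
have hJ : conjc h = h by exact: conjc_real.
have kJ : conjc k = - k by apply/eqP; rewrite eq_complex/= oppr0 opprK !eqxx.
have ik : 'i%C * k = h.
  by apply/eqP; rewrite eq_complex/=; apply/andP; split; apply/eqP; ring.
have ch : cabs h = 2^-1 by rewrite cabs_real ger0_norm// invr_ge0.
have ck : cabs k = 2^-1.
  rewrite /cabs normc_def/= expr0n/= add0r sqrrN sqrtr_sqr ger0_norm ?invr_ge0//.
pose A1 x := h *: (N x + N' x); pose A2 x := k *: (N x - N' x).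
have s1 : adjoint_pair A1 A1.
  by move=> x y; rewrite /A1 ipZl ipZr hJ ipDl ipDr hN hN' addrC.
have s2 : adjoint_pair A2 A2.
  by move=> x y; rewrite /A2 ipZl ipZr kJ ipBl ipBr hN hN' mulNr -mulrN opprB.
have b1 : norm_bound A1 M.
  move=> x; rewrite /A1 nrmZ ch; have := nrmD (N x) (N' x).
  by have := bN x; have := bN' x; lra.
have b2 : norm_bound A2 M.
  move=> x; rewrite /A2 nrmZ ck; have := nrmB (N x) (N' x).
  by have := bN x; have := bN' x; lra.
have bA1 x : b (A1 x) <= K * b x.
  rewrite /A1 sb.2 ch; have := sb.1 (N x) (N' x).
  by have := bK x; have := bK' x; lra.
have bA2 x : b (A2 x) <= K * b x.
  rewrite /A2 sb.2 ck; have := sb.1 (N x) (- N' x).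
  rewrite -scaleN1r sb.2 /cabs normrN1/= mul1r scaleN1r.
  by have := bK x; have := bK' x; lra.
have l1 := adjoint_pair_linear s1; have l2 := adjoint_pair_linear s2.
have c12 x : A1 (A2 x) = A2 (A1 x).
  rewrite /A1 /A2 !(linearopZ _ _ lN) !(linearopZ _ _ lN').
  rewrite !(linearopB _ _ lN) !(linearopB _ _ lN') !(linearopD _ _ lN) !(linearopD _ _ lN').
  rewrite -scalerDr -scalerBr !scalerA [h * k]mulrC; congr (_ *: _).
  by rewrite cN addrA subrK opprD addrA addrK.
have [r1 [d1 _]] := degenerate_selfadjoint sb db s1 M0 b1 K0 bA1.
have sb1 := seminormD sb (seminorm_op (linear_shift r1%:C l1)).
have [||r2 [d2 _]] := degenerate_selfadjoint sb1 d1 s2 M0 b2 (K := K + M).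
- by rewrite addr_ge0.
- move=> x; rewrite mulrDl.
  have -> : A1 (A2 x) - r1%:C *: A2 x = A2 (A1 x - r1%:C *: x).
    by rewrite (linearopB _ _ l2) (linearopZ _ _ l2) c12.
  have := bA2 x; have := b2 (A1 x - r1%:C *: x).
  have := mulr_ge0 K0 (nrm_ge0 (A1 x - r1%:C *: x)).
  have := mulr_ge0 M0 (seminorm_ge0 x sb).
  rewrite !mulrDr; lra.
exists (r1%:C + 'i%C * r2%:C); apply: degenerate_le d2 => [x|]; last exact: ler01.
rewrite mul1r -addrA lerD2l.
have -> : N x - (r1%:C + 'i%C * r2%:C) *: x =
    (A1 x - r1%:C *: x) + 'i%C *: (A2 x - r2%:C *: x).
  rewrite scalerBr scalerDl opprD addrACA -[in LHS]scalerA; congr (_ + _).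
  rewrite /A1 /A2 scalerA ik -scalerDr addrACA subrr addr0 scalerDr -scalerDl hh.
  by rewrite scale1r.
apply: le_trans (nrmD _ _) _; rewrite nrmZ.
by rewrite /cabs normc_def/= expr0n/= add0r expr1n sqrtr1 mul1r.
Qed.

(* A gliding hump: [y] is the sum of the [4 ^- n x_n] over a set of indices chosen so
   that [<y, x_n>] is never small. *)
Lemma gliding_hump (u : nat -> H) : (forall n, nrm (u n) = 1) ->
  exists y, forall n, 4^-1 ^+ n / 6 <= cabs (ip y (u n)).
Proof.
move=> u1; pose w n : R := 4^-1 ^+ n.
have w0 n : 0 < w n by rewrite exprn_gt0// invr_gt0.
have wS n : w n = 4 * w n.+1 by rewrite /w exprS; field.
pose Y := fix Y n : H := if n is m.+1 then
   (if cabs (ip (Y m) (u m)) < w m / 2 then Y m + (w m)%:C *: u m else Y m) else 0.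
have big n : w n / 2 <= cabs (ip (Y n.+1) (u n)).
  rewrite /=; case: ltP => // h.
  rewrite ipDl ipZl ipxx u1 expr1n mulr1.
  have := cabsD (ip (Y n) (u n) + (w n)%:C) (- ip (Y n) (u n)).
  rewrite addrAC subrr add0r cabs_real gtr0_norm//.
  rewrite [cabs (- _)]/cabs normrN -/(cabs _); lra.
have stepY n : nrm (Y n.+1 - Y n) <= w n.
  rewrite /=; case: ifP => _; last by rewrite subrr nrm0 ltW.
  by rewrite addrAC subrr add0r nrmZ u1 mulr1 cabs_real gtr0_norm.
have tail n m : nrm (Y (n + m)%N - Y n) <= (w n - w (n + m)%N) * (4 / 3).
  elim: m => [|m IH]; first by rewrite addn0 !subrr nrm0 mul0r.
  rewrite addnS; have := nrmD (Y (n + m).+1 - Y (n + m)%N) (Y (n + m)%N - Y n).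
  by rewrite addrA subrK; have := stepY (n + m)%N; have := wS (n + m)%N; lra.
have tail2 n m : (n <= m)%N -> nrm (Y m - Y n) <= w n * (4 / 3).
  by move=> nm; have := tail n (m - n)%N; rewrite subnKC//; have := w0 m; lra.
have [|l hl] := @complete_nrm _ _ Y.
  move=> e e0.
  have [n0 hn0] : exists n, w n * (8 / 3) <= e.
    have : (4^-1 : R) ^+ n @[n --> \oo] --> (0:R).
      by apply: cvg_expr; rewrite ger0_norm ?invr_ge0// invf_lt1// ltr1n.
    move=> /cvgr0Pnorm_lt /(_ (e / 4)); rewrite divr_gt0// => /(_ isT) [n _ h].
    by exists n; have := h n (leqnn n); rewrite /= -/(w n) gtr0_norm//; lra.
  exists n0 => n k hn hk; have := nrmB (Y n - Y n0) (Y k - Y n0).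
  rewrite opprB addrA subrK.
  by have := tail2 _ _ hn; have := tail2 _ _ hk; lra.
exists l => n; apply/ler_addgt0Pr => e e0; have [n0 hn0] := hl e e0.
pose m := maxn n0 n.+1.
(* The constant 6: the inner product with [Y n.+1] is at least [w n / 2], and the later terms change
   it by at most [w n.+1 * 4 / 3 = w n / 3]. *)
have h1 := hn0 m (leq_maxl _ _); have h2 := tail2 n.+1 m (leq_maxr _ _).
have h3 := big n; have h4 := wS n.
have h5 : nrm (Y n.+1 - l) <= w n.+1 * (4 / 3) + e.
  have := nrmB (Y m - l) (Y m - Y n.+1).
  by rewrite opprB addrC addrA subrK; lra.
have := cabsD (ip l (u n)) (ip (Y n.+1 - l) (u n)); rewrite -ipDl addrC subrK.
have := cauchy_schwarz (Y n.+1 - l) (u n); rewrite u1 mulr1.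
by rewrite -/(w n); have := w0 n; lra.
Qed.

(** By normality the shifted adjoints [A'], [B'] are as small on [x] as [A], [B]. Unit vectors [u n]
    on which they have size [8 ^- n] give [|<y, u n>| <= C 8 ^- n] for every [y] in the range of the
    Koszul map, which the hump of size [4 ^- n / 6] violates. *)
Lemma degenerate_taylor S S' P P' s p :
  adjoint_pair S S' -> adjoint_pair P P' ->
  (forall x, S (S' x) = S' (S x)) -> (forall x, P (P' x) = P' (P x)) ->
  degenerate (fun x => nrm (S x - s *: x) + nrm (P x - p *: x)) ->
  taylor_spectrum S P (s, p).
Proof.
move=> hS hP cS cP dg [_ _ onto].
have lS' := adjoint_pair_linear hS; have lP' := adjoint_pair_linear hP.
have lS := adjoint_pair_linear (adjoint_pairC hS).
have lP := adjoint_pair_linear (adjoint_pairC hP).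
pose A x := S x - s *: x; pose A' x := S' x - conjc s *: x.
pose B x := P x - p *: x; pose B' x := P' x - conjc p *: x.
have hA : adjoint_pair A A' := adjoint_pair_shift s hS.
have hB : adjoint_pair B B' := adjoint_pair_shift p hP.
have nA x : nrm (A' x) = nrm (A x).
  by apply: nrm_normal => // {}x; exact: commute_shift.
have nB x : nrm (B' x) = nrm (B x).
  by apply: nrm_normal => // {}x; exact: commute_shift.
have seq (n : nat) : exists x, nrm x = 1 /\ nrm (A' x) + nrm (B' x) <= 8^-1 ^+ n.
  have [|x x0 hx] := dg (8^-1 ^+ n); first by rewrite exprn_gt0// invr_gt0.
  have k0 : 0 < (nrm x)^-1 by rewrite invr_gt0.
  exists (((nrm x)^-1)%:C *: x); rewrite nA nB.
  have lA : linear A := linear_shift s lS; have lB : linear B := linear_shift p lP.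
  rewrite (linearopZ _ _ lA) (linearopZ _ _ lB) !nrmZ cabs_real gtr0_norm//.
  rewrite mulVf ?gt_eqF//; split=> //.
  by rewrite -mulrDr mulrC ler_pdivrMr.
have [u hu] := choice seq.
have [n|y hy] := @gliding_hump u; first exact: (hu n).1.
have : [set: H] y by [].
rewrite -onto => -[[w1 w2] _]; rewrite /koszul1/= => yE.
have {}yE : y = A w2 - B w1 by rewrite -yE.
pose C := nrm w1 + nrm w2.
have bnd n : 4^-1 ^+ n / 6 <= 8^-1 ^+ n * C.
  apply: le_trans (hy n) _; rewrite yE ipBl hA hB.
  apply: le_trans (cabsD _ _) _; rewrite /cabs normrN -!/(cabs _).
  have := cauchy_schwarz w2 (A' (u n)); have := cauchy_schwarz w1 (B' (u n)).
  have := (hu n).2; have := nrm_ge0 (A' (u n)); have := nrm_ge0 (B' (u n)).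
  have := nrm_ge0 w1; have := nrm_ge0 w2.
  rewrite /C; nra.
have [n hn] : exists n, 6 * C < 2 ^+ n.
  exists (Num.truncn (6 * C)).+1; apply: lt_le_trans (truncnS_gt _) _.
  by rewrite -natrX ler_nat ltnW// ltn_expl.
have := bnd n; apply/negP; rewrite -ltNge.
have -> : 4^-1 ^+ n = 8^-1 ^+ n * 2 ^+ n :> R.
  by rewrite -exprMn; congr (_ ^+ _); field.
by rewrite -mulrA ltr_pM2l ?exprn_gt0 ?invr_gt0// ltr_pdivlMr//; lra.
Qed.

(** [Z = A'A + B'B] is bijective and commutes with [A] and [B]; its inverse composed with [A'] and
    [B'] is a contracting homotopy of the complex. *)
Lemma coercive_koszul_exact A A' B B' (M c : R) :
  adjoint_pair A A' -> adjoint_pair B B' -> 0 <= M -> norm_bound A M -> norm_bound B M ->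
  (forall x, A (A' x) = A' (A x)) -> (forall x, B (B' x) = B' (B x)) ->
  (forall x, A (B x) = B (A x)) -> (forall x, A (B' x) = B' (A x)) ->
  (forall x, B (A' x) = A' (B x)) ->
  0 < c -> (forall x, c * nrm x ^+ 2 <= nrm (A x) ^+ 2 + nrm (B x) ^+ 2) ->
  koszul_exact A B.
Proof.
move=> hA hB M0 bA bB nA nB cAB cAB' cBA' c0 hc.
have lA' := adjoint_pair_linear hA; have lB' := adjoint_pair_linear hB.
have lA := adjoint_pair_linear (adjoint_pairC hA).
have lB := adjoint_pair_linear (adjoint_pairC hB).
have bA' := adjoint_pair_bound M0 hA bA; have bB' := adjoint_pair_bound M0 hB bB.
pose Z x := A' (A x) + B' (B x).
have lZ : linear Z.
  by move=> a x y; rewrite /Z lA lB lA' lB' scalerDr addrACA.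
have sZ : adjoint_pair Z Z.
  by move=> x y; rewrite /Z ipDl ipDr !(adjoint_pairC hA) !(adjoint_pairC hB) hA hB.
have bZ : norm_bound Z (2 * M ^+ 2).
  move=> x; apply: le_trans (nrmD _ _) _.
  have := bA' (A x); have := bB' (B x).
  have := ler_wpM2l M0 (bA x); have := ler_wpM2l M0 (bB x).
  lra.
have cZ x : c * nrm x ^+ 2 <= Re (ip (Z x) x).
  apply: le_trans (hc x) _; rewrite /Z ipDl raddfD/=.
  by rewrite (adjoint_pairC hA) (adjoint_pairC hB) -!nrm_sqr.
have injZ x : Z x = 0 -> x = 0.
  move=> zx; apply: nrm_eq0; apply/eqP; rewrite -sqrf_eq0; apply/eqP.
  by have := cZ x; rewrite zx ip0l/=; have := sqr_ge0 (nrm x); nra.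
have ontoZ y : exists x, Z x = y.
  have [|||u hu] := @lax_milgram R H Z (fun x => ip x y) (2 * M ^+ 2) c (nrm y)
    lZ _ bZ sZ c0 cZ _ (nrm_ge0 y).
  - by rewrite mulr_ge0// sqr_ge0.
  - by move=> a x z; rewrite ipDl ipZl.
  - by move=> x; rewrite mulrC; exact: cauchy_schwarz.
  by exists u; apply: eq_of_ip => z; rewrite hu sZ.
split; rewrite /koszul0 /koszul1.
- apply/seteqP; split => [x [Ax Bx]|x ->] /=.
    by apply: injZ; rewrite /Z Ax Bx (linearop0 lA') (linearop0 lB') addr0.
  by rewrite (linearop0 lA) (linearop0 lB).
- apply/seteqP; split => [[w1 w2] /= /eqP|[w1 w2] [x _ [<- <-]]] /=; last first.
    by rewrite cAB subrr.
  rewrite subr_eq0 => /eqP e.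
  (* Since [A w2 = B w1], applying [A] to the right side gives [A'A w1 + B'B w1 = Z w1], and
     likewise [Z w2] for [B]. *)
  have [x hx] := ontoZ (A' w1 + B' w2).
  have ZA : Z (A x) = A (Z x) by rewrite /Z (linearopD _ _ lA) nA cAB' cAB.
  have ZB : Z (B x) = B (Z x) by rewrite /Z (linearopD _ _ lB) nB cBA' cAB.
  have eqZ v w : Z v = Z w -> v = w.
    move=> h; apply/eqP; rewrite -subr_eq0; apply/eqP; apply: injZ.
    by rewrite (linearopB _ _ lZ) h subrr.
  exists x => //; congr (_, _); apply: eqZ.
    by rewrite ZA hx (linearopD _ _ lA) nA cAB' e.
  by rewrite ZB hx (linearopD _ _ lB) nB cBA' -e.
- apply/seteqP; split => // y _; have [u hu] := ontoZ y.
  exists (- B' u, A' u) => //=.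
  have -> : B (- B' u) = - B (B' u) by rewrite -sub0r (linearopB _ _ lB) (linearop0 lB) sub0r.
  by rewrite opprK nA nB.
Qed.

End Normal.

Lemma le0_of_small (R : realType) (a k : R) :
  (forall e, 0 < e -> e <= 1 -> a <= e * k) -> a <= 0.
Proof.
move=> h; rewrite leNgt; apply/negP => a0.
have k1 : 0 < `|k| + 1 by rewrite ltr_wpDl.
pose e := Num.min 1 (a / (2 * (`|k| + 1))).
have e0 : 0 < e by rewrite lt_min ltr01 divr_gt0// mulr_gt0.
have e1 : e <= 1 by rewrite ge_min lexx.
have ek : e * (2 * (`|k| + 1)) <= a.
  by rewrite -ler_pdivlMr ?mulr_gt0// /e ge_min lexx orbT.
have := h e e0 e1; have := ler_wpM2l (ltW e0) (ler_norm k).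
by move: ek; rewrite !mulrDr; nra.
Qed.

(** * Uniqueness of positive square roots *)

Section PositiveOperators.
Context {R : realType} {H : hilbertSpace R}.
Implicit Types (x y z : H) (A B T : H -> H).

Lemma positive_Re T x : positive_operator T -> 0 <= Re (ip (T x) x).
Proof. by move=> [_ /(_ x)]; rewrite lecE => /andP[]. Qed.

Lemma positive_selfadjoint T : positive_operator T -> adjoint_pair T T.
Proof.
move=> [bT pT]; have hT := adjointP bT; set T' := adjoint T in hT.
have [lT _] := bounded_operatorP bT; have lT' := adjoint_pair_linear hT.
suff TT' x : T x = T' x by move=> x y; rewrite hT TT'.
apply: eq_of_ip => {}y; apply/eqP; rewrite -subr_eq0 -ipBr; apply/eqP.
(* The form [<z, D z>] vanishes because [<T z, z>] is real; complex polarization, at [x] and at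
   ['i *: x], then gives [D = 0]. *)
pose D z := T z - T' z.
have DD x1 x2 : D (x1 + x2) = D x1 + D x2.
  by rewrite /D (linearopD _ _ lT) (linearopD _ _ lT') opprD addrACA.
have DZ a z : D (a *: z) = a *: D z.
  by rewrite /D (linearopZ _ _ lT) (linearopZ _ _ lT') scalerBr.
have D0 z : ip z (D z) = 0.
  rewrite /D ipBr -hT [ip z (T z)]ipC.
  have := pT z; rewrite -/(ip (T z) z); case: (ip (T z) z) => u v.
  by rewrite lecE/= => /andP[/eqP -> _]; rewrite oppr0 subrr.
have -> : ip y (T x - T' x) = ip y (D x) by [].
clearbody D.
have pol u v : ip u (D v) + ip v (D u) = 0.
  by have := D0 (u + v); rewrite DD ipDl !ipDr !D0 add0r addr0.
have := pol y x; have := pol y ('i%C *: x).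
rewrite DZ ipZr ipZl.
move: (ip y (D x)) (ip x (D y)) => [a b] [c d] /= [h1 h2] [h3 h4].
by apply/eqP; rewrite eq_complex/=; apply/andP; split; apply/eqP; lra.
Qed.

(** [A] and [B] need not commute, but [A ^ 2 = B ^ 2] makes [C = A + B] and [X = A - B] anticommute,
    so [X ^ 2] commutes with [C]. A joint approximate eigenvalue [(m, g)] of [(X ^ 2, C)] with
    [m <> 0], present if [X] is nonzero, is then contradictory. *)
Lemma sqrt_unique A B : positive_operator A -> positive_operator B ->
  (forall x, A (A x) = B (B x)) -> A = B.
Proof.
move=> pA pB AB.
have sA := positive_selfadjoint pA; have sB := positive_selfadjoint pB.
have lA := adjoint_pair_linear sA; have lB := adjoint_pair_linear sB.
have [_ [MA MA0 bA]] := bounded_operatorP pA.1.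
have [_ [MB MB0 bB]] := bounded_operatorP pB.1.
pose C x := A x + B x; pose X x := A x - B x; pose M := MA + MB.
have M0 : 0 <= M by rewrite addr_ge0.
have sC : adjoint_pair C C by move=> x y; rewrite /C ipDl ipDr sA sB.
have sX : adjoint_pair X X by move=> x y; rewrite /X ipBl ipBr sA sB.
have lC := adjoint_pair_linear sC; have lX := adjoint_pair_linear sX.
have bC : norm_bound C M.
  by move=> x; apply: le_trans (nrmD _ _) _; rewrite mulrDl lerD.
have bX : norm_bound X M.
  by move=> x; apply: le_trans (nrmB _ _) _; rewrite mulrDl lerD.
have CX x : C (X x) = - X (C x).
  rewrite /C /X (linearopB _ _ lA) (linearopB _ _ lB) (linearopD _ _ lA) (linearopD _ _ lB).
  by rewrite AB opprB [LHS]addrC [LHS]addrA subrK opprD [RHS]addrA addrK.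
have C0 x : 0 <= Re (ip (C x) x).
  by rewrite /C ipDl raddfD/= addr_ge0//; exact: positive_Re.
have cmp z : Re (ip (X z) z) <= Re (ip (C z) z) /\ - Re (ip (X z) z) <= Re (ip (C z) z).
  rewrite /X /C ipBl ipDl !raddfD raddfN/=.
  by have := positive_Re z pA; have := positive_Re z pB; split; lra.
apply/funext => x0; apply/eqP; rewrite -subr_eq0; apply/eqP.
rewrite -/(X x0); clearbody C X.
pose X2 x := X (X x).
have CX2 x : C (X2 x) = X2 (C x).
  by rewrite /X2 !CX -[- X (C x)]sub0r (linearopB _ _ lX) (linearop0 lX) sub0r opprK.
have sX2 : adjoint_pair X2 X2 by move=> x y; rewrite /X2 !sX.
have lX2 := adjoint_pair_linear sX2.
have bX2 : norm_bound X2 (M * M).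
  by move=> x; apply: le_trans (bX _) _; rewrite -mulrA ler_wpM2l.
apply: contrapT => Xx0.
have X2x0 : X2 x0 <> 0.
  move=> h; apply: Xx0; apply: nrm_eq0; apply/eqP; rewrite -sqrf_eq0 nrm_sqr sX.
  by rewrite -/(X2 x0) h ip0r.
have nx0 : 0 < nrm x0.
  rewrite lt_def nrm_ge0 andbT; apply/eqP => /nrm_eq0 h.
  by apply: X2x0; rewrite h (linearop0 lX2).
have d0 : degenerate (fun _ : H => 0 : R).
  by move=> e e0; exists x0 => //; rewrite mulr_ge0 ?nrm_ge0// ltW.
have [m [dm hm]] := degenerate_selfadjoint (@seminorm0 R H) d0 sX2
  (mulr_ge0 M0 M0) bX2 (lexx 0) (fun x => eq_ind_r (fun t => 0 <= t) (lexx 0) (mul0r 0)).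
have m0 : 0 < `|m|.
  have c0 : 0 < nrm (X2 x0) / nrm x0.
    rewrite divr_gt0// lt_def nrm_ge0 andbT; apply/eqP => /nrm_eq0; exact: X2x0.
  apply: lt_le_trans c0 (hm _ _) => e e0; exists x0; split=> //.
    by rewrite mulr_ge0 ?nrm_ge0// ltW.
  by rewrite divfK// gt_eqF.
pose b x := nrm (X2 x - m%:C *: x).
have sb : is_seminorm b by exact: seminorm_op (linear_shift m%:C lX2).
have db : degenerate b.
  by apply: (degenerate_le (K := 1) _ ler01 dm) => x; rewrite mul1r add0r.
have bCb x : b (C x) <= M * b x.
  by rewrite /b -CX2 -(linearopZ _ _ lC) -(linearopB _ _ lC).
have [g [dg _]] := degenerate_selfadjoint sb db sC M0 bC M0 bCb.
pose n2 x := nrm x ^+ 2.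
have test (e : R) : 0 < e -> e <= 1 -> exists x, [/\ 0 < n2 x,
    - e * n2 x <= Re (ip (X2 x) x) - m * n2 x <= e * n2 x,
    - e * n2 x <= Re (ip (C x) x) - g * n2 x <= e * n2 x &
    Re (ip (C x) (X2 x)) >= g * n2 (X x) - e * (`|m| + 1) * n2 x].
  move=> e0 e1; have [x x0' hx] := dg e e0; exists x.
  have h1 : b x <= e * nrm x by have := nrm_ge0 (C x - g%:C *: x); lra.
  have h2 : nrm (C x - g%:C *: x) <= e * nrm x by have := seminorm_ge0 x sb; lra.
  have near (T : H -> H) (t : R) y : nrm (T x - t%:C *: x) <= e * nrm x ->
     - (e * nrm x * nrm y) <= Re (ip (T x) y) - t * Re (ip x y) <= e * nrm x * nrm y.
    move=> h; have -> : Re (ip (T x) y) - t * Re (ip x y) = Re (ip (T x - t%:C *: x) y).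
      by rewrite ipBl ipZl raddfB/=; case: (ip x y) => u v /=; rewrite mul0r subr0.
    have k := ler_wpM2r (nrm_ge0 y) h.
    have := Re_ip_le (T x - t%:C *: x) y; have := Re_ip_le (- (T x - t%:C *: x)) y.
    by rewrite ipNl raddfN/= nrmN; lra.
  have nn : Re (ip x x) = n2 x by rewrite /n2 nrm_sqr.
  have := near X2 m x h1; have := near C g x h2; have := near C g (X2 x) h2.
  rewrite nn -!mulrA -!expr2 -/(n2 x) => /andP[k1 k2] /andP[k3 k4] /andP[k5 k6].
  split; [by rewrite exprn_gt0|by rewrite mulNr k5|by rewrite mulNr k3|].
  have -> : n2 (X x) = Re (ip x (X2 x)) by rewrite /n2 nrm_sqr sX.
  have nX2 : nrm (X2 x) <= (`|m| + 1) * nrm x.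
    have := nrmD (X2 x - m%:C *: x) (m%:C *: x); rewrite subrK nrmZ cabs_real.
    have := ler_wpM2r (ltW x0') e1; rewrite -/(b x); lra.
  have := ler_wpM2l (mulr_ge0 (ltW e0) (ltW x0')) nX2.
  by rewrite /n2; lra.
have Xn2 x : Re (ip (X2 x) x) = n2 (X x) by rewrite /n2 nrm_sqr -sX.
have CX2X x : Re (ip (C x) (X2 x)) = - Re (ip (C (X x)) (X x)).
  by rewrite CX ipNl raddfN/= opprK sX.
have g0 : 0 <= g.
  rewrite -oppr_le0; apply: (@le0_of_small _ _ 1) => e e0 e1.
  have [x [x0' _ /andP[_ h] _]] := test e e0 e1.
  by rewrite -(ler_pM2r x0') mulr1; have := C0 x; lra.
have mp : 0 <= m.
  rewrite -oppr_le0; apply: (@le0_of_small _ _ 1) => e e0 e1.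
  have [x [x0' /andP[_ h] _ _]] := test e e0 e1.
  by rewrite -(ler_pM2r x0') mulr1; have := sqr_ge0 (nrm (X x)); rewrite Xn2 /n2 in h *; lra.
rewrite ger0_norm// in m0.
(* [<C x, X ^ 2 x>] is close to [g m] times the squared norm of [x], but anticommutation makes it
   [- <C (X x), X x>], which is not positive. *)
have gm : g * m <= 0.
  apply: (@le0_of_small _ _ (g + m + 1)) => e e0 e1.
  have [x [x0' /andP[h1 _] _ h2]] := test e e0 e1.
  rewrite -(ler_pM2r x0'); rewrite CX2X ger0_norm// in h2; rewrite Xn2 in h1.
  have := ler_wpM2l g0 h1; have := C0 (X x).
  by lra.
have gz : g = 0.
  by apply/eqP; rewrite eq_le g0 andbT; rewrite -(ler_pM2r m0) mul0r.
have : m <= 0.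
  apply: (@le0_of_small _ _ (2 + m / 2)) => e e0 e1.
  have [x [x0' /andP[h1 _] /andP[_ h3] h2]] := test e e0 e1.
  rewrite CX2X gz mul0r ger0_norm// in h2; rewrite gz mul0r subr0 in h3; rewrite Xn2 in h1.
  rewrite -(ler_pM2r x0').
  (* Adding the comparisons at [x + X x] and [x - X x] cancels the odd terms and bounds
     [4 |X x| ^ 2] by [2 <C x, x> + 2 <C (X x), X x>]. Both summands are small as [g = 0], while
     [|X x| ^ 2] is close to [m |x| ^ 2]. *)
  have [k1 _] := cmp (x + X x); have [_ k2] := cmp (x - X x).
  move: k1 k2; rewrite (linearopD _ _ lX) (linearopB _ _ lX) (linearopD _ _ lC) (linearopB _ _ lC).
  have ReD (u v : R[i]) : Re (u + v) = Re u + Re v by case: u v => [? ?] [? ?].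
  have ReN (u : R[i]) : Re (- u) = - Re u by case: u.
  rewrite -/(X2 x); clearbody X2.
  rewrite !(ipDl, ipDr, ipNl, ipNr) !(ReD, ReN).
  have -> : Re (ip (X x) (X x)) = n2 (X x) by rewrite /n2 nrm_sqr.
  rewrite Xn2.
  by lra.
by lra.
Qed.

End PositiveOperators.

(** * Commuting normal pairs *)

Section CommutingNormalPair.
Context {R : realType} {H : hilbertSpace R}.
Context (S S' P P' : H -> H) (MS MP : R)
  (hS : adjoint_pair S S') (hP : adjoint_pair P P')
  (MS0 : 0 <= MS) (bS : norm_bound S MS) (MP0 : 0 <= MP) (bP : norm_bound P MP)
  (nS : forall x, S (S' x) = S' (S x)) (nP : forall x, P (P' x) = P' (P x))
  (cSP : forall x, S (P x) = P (S x)).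

Let lS : linear S := adjoint_pair_linear (adjoint_pairC hS).
Let lP : linear P := adjoint_pair_linear (adjoint_pairC hP).
Let lS' : linear S' := adjoint_pair_linear hS.
Let lP' : linear P' := adjoint_pair_linear hP.
Let bS' : norm_bound S' MS := adjoint_pair_bound MS0 hS bS.
Let bP' : norm_bound P' MP := adjoint_pair_bound MP0 hP bP.

Lemma adjoint_commute x : S' (P' x) = P' (S' x).
Proof. by apply: eq_of_ip => z; rewrite -hS -hP -hP -hS cSP. Qed.

Lemma nrm_shift_adjoint (T T' : H -> H) (a : R[i]) x : adjoint_pair T T' ->
  (forall x, T (T' x) = T' (T x)) -> nrm (T' x - conjc a *: x) = nrm (T x - a *: x).
Proof.
move=> hT nT; apply: (nrm_normal x (adjoint_pair_shift a hT)) => y.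
have lT' := adjoint_pair_linear hT; have lT := adjoint_pair_linear (adjoint_pairC hT).
exact: commute_shift.
Qed.

Lemma adjoint_product_shift (T T' : H -> H) (M : R) (a : R[i]) x : adjoint_pair T T' ->
  (forall x, T (T' x) = T' (T x)) -> 0 <= M -> norm_bound T M ->
  nrm (T' (T x) - (cabs a ^+ 2)%:C *: x) <= (M + cabs a) * nrm (T x - a *: x).
Proof.
move=> hT nT M0 bT; have lT' := adjoint_pair_linear hT.
have -> : T' (T x) - (cabs a ^+ 2)%:C *: x = T' (T x - a *: x) + a *: (T' x - conjc a *: x).
  by rewrite (linearopB _ _ lT') (linearopZ _ _ lT') scalerBr addrA subrK scalerA mulCJ.
apply: le_trans (nrmD _ _) _; rewrite nrmZ (nrm_shift_adjoint a x hT nT) mulrDl lerD2r.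
exact: (adjoint_pair_bound M0 hT bT).
Qed.

Lemma eq_of_approx (u : H -> H) (r t K : R) :
  (forall e, 0 < e -> exists x, [/\ 0 < nrm x, nrm (u x - r%:C *: x) <= e * nrm x &
    nrm (u x - t%:C *: x) <= e * K * nrm x]) -> r = t.
Proof.
move=> h; apply/eqP; rewrite -subr_eq0 -normr_eq0 eq_le normr_ge0 andbT.
apply: (@le0_of_small _ _ (1 + K)) => e e0 _; have [x [xx h1 h2]] := h e e0.
rewrite -(ler_pM2r xx) -cabs_real -nrmZ rmorphB scalerBl.
have -> : r%:C *: x - t%:C *: x = (u x - t%:C *: x) - (u x - r%:C *: x).
  by rewrite opprB [RHS]addrC [RHS]addrA subrK.
by apply: le_trans (nrmB _ _) _; lra.
Qed.

Lemma nrm_commute_shift (T A : H -> H) (M : R) (a : R[i]) x : linear T -> norm_bound T M ->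
  (forall x, A (T x) = T (A x)) -> nrm (A (T x) - a *: T x) <= M * nrm (A x - a *: x).
Proof.
by move=> lT bT c; rewrite c -(linearopZ _ _ lT) -(linearopB _ _ lT).
Qed.

Lemma degenerate0 (x : H) : 0 < nrm x -> degenerate (fun _ : H => 0 : R).
Proof. by move=> x0 e e0; exists x => //; rewrite mulr_ge0 ?nrm_ge0// ltW. Qed.

(* [S'] preserves the approximate eigenspaces of [P], although it is not known to
   commute with [P]: these are also approximate eigenspaces of [P']. *)
Lemma extend_eigenvalue p : degenerate (fun x => nrm (P x - p *: x)) ->
  exists s, degenerate (fun x => nrm (P x - p *: x) + nrm (S x - s *: x)).
Proof.
move=> dp; apply: (degenerate_normal (seminorm_op (linear_shift p lP)) dp hS nS MS0 bS MS0).
  by move=> x; apply: nrm_commute_shift.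
move=> x; rewrite -(nrm_shift_adjoint p (S' x) hP nP) -(nrm_shift_adjoint p x hP nP).
by apply: nrm_commute_shift => // y; rewrite adjoint_commute.
Qed.

Lemma selfadjoint_approximate (A : H -> H) (MA : R) x0 :
  adjoint_pair A A -> 0 <= MA -> norm_bound A MA -> 0 < nrm x0 ->
  exists r : R, degenerate (fun x => nrm (A x - r%:C *: x)) /\
    nrm (A x0) / nrm x0 <= `|r|.
Proof.
move=> sA MA0 bA x00.
have b0 (x : H) : (0 : R) <= 0 * 0 by rewrite mul0r.
have [r [dr hr]] := degenerate_selfadjoint (@seminorm0 R H) (degenerate0 x00) sA MA0 bA
  (lexx 0) b0.
exists r; split.
  by apply: (degenerate_le (K := 1) _ ler01 dr) => x; rewrite mul1r add0r.
apply: hr => e e0; exists x0; split=> //; first by rewrite mulr_ge0 ?nrm_ge0// ltW.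
by rewrite divfK// gt_eqF.
Qed.

Lemma isometry_of_spectrum :
  (forall s p, taylor_spectrum S P (s, p) -> cabs p = 1) -> forall x, P' (P x) = x.
Proof.
move=> hsp x0; apply/eqP; rewrite -subr_eq0; apply/eqP; apply: contrapT => nx0.
pose T x := P' (P x) - x.
have sT : adjoint_pair T T.
  by move=> x y; rewrite /T ipBl ipBr (adjoint_pairC hP) hP.
have bT : norm_bound T (MP * MP + 1).
  move=> x; apply: le_trans (nrmB _ _) _; rewrite mulrDl mul1r lerD2r.
  by apply: le_trans (bP' _) _; rewrite -mulrA ler_wpM2l.
have lT := adjoint_pair_linear sT.
have x00 : 0 < nrm x0.
  rewrite lt_def nrm_ge0 andbT; apply/eqP => /nrm_eq0 h; apply: nx0.
  by rewrite -/(T x0) h (linearop0 lT).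
have T0 : 0 < nrm (T x0).
  by rewrite lt_def nrm_ge0 andbT; apply/eqP => /nrm_eq0.
have [|r [dr hr]] := selfadjoint_approximate sT _ bT x00.
  by rewrite addr_ge0// mulr_ge0.
have PT x : T (P x) = P (T x) by rewrite /T (linearopB _ _ lP) nP.
have P'T x : T (P' x) = P' (T x) by rewrite /T (linearopB _ _ lP') nP.
have [||p dp] := degenerate_normal (seminorm_op (linear_shift r%:C lT)) dr hP nP MP0 bP MP0.
- by move=> x; apply: nrm_commute_shift.
- by move=> x; apply: nrm_commute_shift.
have rE : r = cabs p ^+ 2 - 1.
  apply: (@eq_of_approx T _ _ (MP + cabs p)) => e e0; have [x xx hx] := dp e e0; exists x.
  have h1 : nrm (T x - r%:C *: x) <= e * nrm x by have := nrm_ge0 (P x - p *: x); lra.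
  have h2 : nrm (P x - p *: x) <= e * nrm x by have := nrm_ge0 (T x - r%:C *: x); lra.
  split=> //; have -> : T x - (cabs p ^+ 2 - 1)%:C *: x = P' (P x) - (cabs p ^+ 2)%:C *: x.
    by rewrite rmorphB scalerBl scale1r /T opprB addrA subrK.
  apply: le_trans (adjoint_product_shift p x hP nP MP0 bP) _.
  by have := ler_wpM2l (addr_ge0 MP0 (cabs_ge0 p)) h2; lra.
(* The condition on [T] is dropped here: [S'] is not yet known to preserve it. *)
have {}dp : degenerate (fun x => nrm (P x - p *: x)).
  apply: (degenerate_le (K := 1) _ ler01 dp) => x; rewrite mul1r lerDr.
  exact: nrm_ge0.
have [s ds] := extend_eigenvalue dp.
have p1 : cabs p = 1.
  apply: (hsp s); apply: (degenerate_taylor hS hP nS nP).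
  by apply: (degenerate_le (K := 1) _ ler01 ds) => x; rewrite mul1r addrC.
have : 0 < `|r| by apply: lt_le_trans hr; rewrite divr_gt0.
by rewrite rE p1 expr1n subrr normr0 ltxx.
Qed.

Context (uP : forall x, P' (P x) = x).

(** [P'] is the two-sided inverse of [P] by normality, and an operator commuting with [P] commutes
    with its inverse. *)
Lemma commute_adjoint_right x : S (P' x) = P' (S x).
Proof. by rewrite -{1}[S (P' x)]uP -cSP nP uP. Qed.

Lemma commute_adjoint_left x : P (S' x) = S' (P x).
Proof.
apply: eq_of_ip => z.
by rewrite -(adjoint_pairC hP) -hS -hS commute_adjoint_right (adjoint_pairC hP).
Qed.

(** The eigenvalues are found in the order [A], [P], [S]; each new operator and its adjoint must
    preserve the earlier seminorms, which for [S'] uses that it commutes with [P]. The lower bound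
    on [r] records that [A] is nonzero at [x0]. *)
Lemma joint_approximate (A : H -> H) (MA : R) x0 :
  adjoint_pair A A -> 0 <= MA -> norm_bound A MA -> 0 < nrm x0 ->
  (forall x, A (S x) = S (A x)) -> (forall x, A (P x) = P (A x)) ->
  exists (r : R) (s p : R[i]), [/\ taylor_spectrum S P (s, p),
    nrm (A x0) / nrm x0 <= `|r| &
    forall e : R, 0 < e -> exists x, [/\ 0 < nrm x, nrm (A x - r%:C *: x) <= e * nrm x,
      nrm (S x - s *: x) <= e * nrm x & nrm (P x - p *: x) <= e * nrm x]].
Proof.
move=> sA MA0 bA x00 AS AP.
have lA := adjoint_pair_linear sA.
have adjA (T T' : H -> H) : adjoint_pair T T' -> (forall x, A (T x) = T (A x)) ->
    forall x, A (T' x) = T' (A x).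
  by move=> hT c x; apply: eq_of_ip => z; rewrite -sA -hT -hT -sA c.
have [r [dr hr]] := selfadjoint_approximate sA MA0 bA x00.
have sbr := seminorm_op (linear_shift r%:C lA).
have [||p dp] := degenerate_normal sbr dr hP nP MP0 bP MP0.
- by move=> x; apply: nrm_commute_shift.
- by move=> x; apply: nrm_commute_shift => //; exact: adjA hP AP.
have sbp := seminormD sbr (seminorm_op (linear_shift p lP)).
have [||s ds] := degenerate_normal sbp dp hS nS MS0 bS MS0.
- move=> x; rewrite mulrDr; apply: lerD; first by apply: nrm_commute_shift.
  by apply: nrm_commute_shift.
- move=> x; rewrite mulrDr; apply: lerD; apply: nrm_commute_shift => //.
    exact: adjA hS AS.
  by move=> y; rewrite commute_adjoint_left.
have appr e : 0 < e -> exists x, [/\ 0 < nrm x, nrm (A x - r%:C *: x) <= e * nrm x,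
      nrm (S x - s *: x) <= e * nrm x & nrm (P x - p *: x) <= e * nrm x].
  move=> e0; have [x xx hx] := ds e e0; exists x.
  have := nrm_ge0 (A x - r%:C *: x); have := nrm_ge0 (S x - s *: x).
  by have := nrm_ge0 (P x - p *: x); split=> //; lra.
exists r, s, p; split=> //.
apply: (degenerate_taylor hS hP nS nP); apply: (degenerate_le (K := 1) _ ler01 ds) => x.
by rewrite mul1r addrC lerD2r lerDr nrm_ge0.
Qed.

(** On joint approximate eigenvectors the defect [D = S - S'P] acts nearly as [s - conjc s * p = 0],
    which forces [r = 0] for [A = D'D], although [r] is nonzero if [D] is. *)
Lemma relation_of_spectrum :
  (forall s p, taylor_spectrum S P (s, p) -> cabs p = 1 /\ s = conjc s * p) ->
  forall x, S x = S' (P x).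
Proof.
move=> hsp x0; apply/eqP; rewrite -subr_eq0; apply/eqP; apply: contrapT => nx0.
pose D x := S x - S' (P x); pose D' x := S' x - P' (S x).
have hD : adjoint_pair D D'.
  by move=> x y; rewrite /D /D' ipBl ipBr hS (adjoint_pairC hS) hP.
have lD' := adjoint_pair_linear hD; have lD := adjoint_pair_linear (adjoint_pairC hD).
have MD0 : 0 <= MS + MS * MP by rewrite addr_ge0// mulr_ge0.
have bD : norm_bound D (MS + MS * MP).
  move=> x; apply: le_trans (nrmB _ _) _; rewrite mulrDl lerD// -mulrA.
  by apply: le_trans (bS' _) _; rewrite ler_wpM2l.
have bD' := adjoint_pair_bound MD0 hD bD.
pose A x := D' (D x).
have sA : adjoint_pair A A by move=> x y; rewrite /A (adjoint_pairC hD) hD.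
have bA : norm_bound A ((MS + MS * MP) * (MS + MS * MP)).
  by move=> x; apply: le_trans (bD' _) _; rewrite -mulrA ler_wpM2l.
have DS x : D (S x) = S (D x) by rewrite /D (linearopB _ _ lS) nS cSP.
have DP x : D (P x) = P (D x) by rewrite /D (linearopB _ _ lP) cSP commute_adjoint_left.
have D'S x : D' (S x) = S (D' x).
  by rewrite /D' (linearopB _ _ lS) nS commute_adjoint_right.
have D'P x : D' (P x) = P (D' x).
  by rewrite /D' (linearopB _ _ lP) commute_adjoint_left cSP nP.
have x00 : 0 < nrm x0.
  rewrite lt_def nrm_ge0 andbT; apply/eqP => /nrm_eq0 h; apply: nx0.
  by rewrite -/(D x0) h (linearop0 lD).
have A0 : 0 < nrm (A x0).
  rewrite lt_def nrm_ge0 andbT; apply/eqP => /nrm_eq0 h; apply: nx0.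
  apply: nrm_eq0; apply/eqP; rewrite -sqrf_eq0 nrm_sqr -/(D x0) hD.
  by rewrite -/(A x0) h ip0r.
have [||r [s [p [/hsp[p1 sE] hr happ]]]] := joint_approximate sA (mulr_ge0 MD0 MD0) bA x00.
- by move=> x; rewrite /A DS D'S.
- by move=> x; rewrite /A DP D'P.
have : 0 < `|r| by apply: lt_le_trans hr; rewrite divr_gt0.
apply/negP; rewrite -leNgt.
apply: (@le0_of_small _ _ (1 + (MS + MS * MP) * (2 + MS))) => e e0 e1.
have [x [xx h1 h2 h3]] := happ e e0.
rewrite -(ler_pM2r xx) -cabs_real -nrmZ.
have hDx : nrm (D x) <= e * (2 + MS) * nrm x.
  have -> : D x = (S x - s *: x) - (S' (P x - p *: x) + p *: (S' x - conjc s *: x)).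
    rewrite (linearopB _ _ lS') (linearopZ _ _ lS') scalerBr addrA subrK scalerA.
    by rewrite [p * _]mulrC -sE opprB addrA subrK.
  apply: le_trans (nrmB _ _) _.
  have := nrmD (S' (P x - p *: x)) (p *: (S' x - conjc s *: x)).
  rewrite nrmZ p1 mul1r (nrm_shift_adjoint s x hS nS).
  have := bS' (P x - p *: x); have := ler_wpM2l MS0 h3.
  lra.
have -> : r%:C *: x = A x - (A x - r%:C *: x) by rewrite opprB addrC subrK.
apply: le_trans (nrmB _ _) _.
have := bD' (D x); have := ler_wpM2l MD0 hDx; rewrite -/(A x).
lra.
Qed.

(** A violating vector gives [S'S] an approximate eigenvalue [r] with [4 < |r|], whereas
    [r = |s| ^ 2] at a joint one. *)
Lemma norm_of_spectrum :
  (forall s p, taylor_spectrum S P (s, p) -> cabs s <= 2) ->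
  forall x, nrm (S x) <= 2 * nrm x.
Proof.
move=> hsp x0; rewrite leNgt; apply/negP => h0.
pose A x := S' (S x).
have sA : adjoint_pair A A by move=> x y; rewrite /A (adjoint_pairC hS) hS.
have bA : norm_bound A (MS * MS).
  by move=> x; apply: le_trans (bS' _) _; rewrite -mulrA ler_wpM2l.
have x00 : 0 < nrm x0.
  rewrite lt_def nrm_ge0 andbT; apply/eqP => /nrm_eq0 h; move: h0.
  by rewrite h (linearop0 lS) nrm0 mulr0 ltxx.
have A4 : 4 < nrm (A x0) / nrm x0.
  rewrite ltr_pdivlMr// -(ltr_pM2r x00).
  apply: lt_le_trans (Re_ip_le _ _); rewrite /A (adjoint_pairC hS) -nrm_sqr.
  have -> : 4 * nrm x0 * nrm x0 = (2 * nrm x0) ^+ 2 by ring.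
  by rewrite ltr_pXn2r ?nnegrE ?nrm_ge0// mulr_ge0// nrm_ge0.
have [||r [s [p [/hsp s2 hr happ]]]] := joint_approximate sA (mulr_ge0 MS0 MS0) bA x00.
- by move=> x; rewrite /A -nS.
- by move=> x; rewrite /A cSP commute_adjoint_left.
have rE : r = cabs s ^+ 2.
  apply: (@eq_of_approx A _ _ (MS + cabs s)) => e e0; have [x [xx h1 h2 _]] := happ e e0.
  exists x; split=> //; apply: le_trans (adjoint_product_shift s x hS nS MS0 bS) _.
  by have := ler_wpM2l (addr_ge0 MS0 (cabs_ge0 s)) h2; lra.
have s4 : cabs s ^+ 2 <= 4 by have := cabs_ge0 s; nra.
by move: hr; rewrite rE ger0_norm ?sqr_ge0//; lra.
Qed.

End CommutingNormalPair.

(** * Equations of the distinguished boundary and the spectrum they confine *)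

Lemma bGamma_equations (R : realType) (s p : R[i]) : @bGamma R (s, p) ->
  [/\ cabs p = 1, s = conjc s * p & cabs s <= 2].
Proof.
move=> /bGamma_torus[z1 [z2 [h1 h2 [-> ->]]]].
have c1 : cabs z1 = 1 by rewrite /cabs h1.
have c2 : cabs z2 = 1 by rewrite /cabs h2.
split; first by rewrite cabsM c1 c2 mulr1.
  have J1 : z1 * conjc z1 = 1 by rewrite mulCJ c1 expr1n.
  have J2 : z2 * conjc z2 = 1 by rewrite mulCJ c2 expr1n.
  rewrite conjcD; transitivity ((z1 * conjc z1) * z2 + (z2 * conjc z2) * z1); last by ring.
  by rewrite J1 J2 !mul1r addrC.
by apply: le_trans (cabsD _ _) _; rewrite c1 c2; lra.
Qed.

(** The operator relations pass to approximate eigenvectors, on which [S'] acts nearly as [conjc s]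
    by normality. *)
Lemma degenerate_equations (R : realType) (H : hilbertSpace R) (S S' P : H -> H)
    (s p : R[i]) :
  adjoint_pair S S' -> (forall x, S (S' x) = S' (S x)) ->
  (forall x, nrm (P x) = nrm x) -> (forall x, S x = S' (P x)) ->
  (forall x, nrm (S x) <= 2 * nrm x) ->
  degenerate (fun x => nrm (S x - s *: x) + nrm (P x - p *: x)) ->
  [/\ cabs p = 1, s = conjc s * p & cabs s <= 2].
Proof.
move=> hS nS uP SP bS dg.
have lS' := adjoint_pair_linear hS.
have bS' := adjoint_pair_bound (ler0n R 2) hS bS.
have appr (e : R) : 0 < e -> exists x, [/\ 0 < nrm x,
    nrm (S x - s *: x) <= e * nrm x & nrm (P x - p *: x) <= e * nrm x].
  move=> e0; have [x xx hx] := dg e e0; exists x.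
  have := nrm_ge0 (S x - s *: x); have := nrm_ge0 (P x - p *: x).
  by split=> //; lra.
have tri (y z : H) : nrm y <= nrm z + nrm (z - y).
  have -> : nrm y = nrm (z - (z - y)) by rewrite opprB addrC subrK.
  exact: nrmB.
have p1 : cabs p = 1.
  apply/eqP; rewrite eq_le -(subr_le0 (cabs p)) -(subr_le0 _ (cabs p)).
  apply/andP; split; apply: (@le0_of_small _ _ 1) => e e0 _;
    have [x [xx _ h2]] := appr e e0; rewrite -(ler_pM2r xx) mulrBl mul1r mulr1 -nrmZ.
    by have := tri (p *: x) (P x); rewrite uP; lra.
  by have := tri (P x) (p *: x); rewrite uP -[nrm (p *: x - P x)]nrmN opprB; lra.
split=> //.
  apply/eqP; rewrite -subr_eq0; apply/eqP; apply: cabs_eq0; apply/eqP.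
  rewrite eq_le cabs_ge0 andbT; apply: (@le0_of_small _ _ 4) => e e0 _.
  have [x [xx h1 h2]] := appr e e0; rewrite -(ler_pM2r xx) -nrmZ.
  have -> : (s - conjc s * p) *: x =
      S' (P x - p *: x) + p *: (S' x - conjc s *: x) - (S x - s *: x).
    rewrite (linearopB _ _ lS') (linearopZ _ _ lS') -SP scalerBr addrA subrK scalerA.
    by rewrite opprB [RHS]addrC [RHS]addrA subrK scalerBl [p * _]mulrC.
  apply: le_trans (nrmB _ _) _.
  have := nrmD (S' (P x - p *: x)) (p *: (S' x - conjc s *: x)).
  rewrite nrmZ p1 mul1r (nrm_shift_adjoint s x hS nS).
  by have := bS' (P x - p *: x); lra.
rewrite -subr_le0; apply: (@le0_of_small _ _ 1) => e e0 _.
have [x [xx h1 _]] := appr e e0; rewrite -(ler_pM2r xx) mulrBl mulr1 -nrmZ.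
by have := tri (s *: x) (S x); have := bS x; lra.
Qed.

Lemma coercive_of_nondegenerate (R : realType) (H : hilbertSpace R) (A B : H -> H) :
  ~ degenerate (fun x => nrm (A x) + nrm (B x)) ->
  exists2 c : R, 0 < c & forall x, c * nrm x ^+ 2 <= nrm (A x) ^+ 2 + nrm (B x) ^+ 2.
Proof.
move=> nd; apply: contrapT => nc; apply: nd => e e0; apply: contrapT => ne.
(* The factor 2 comes from [(a + b) ^ 2 <= 2 (a ^ 2 + b ^ 2)]. *)
apply: nc; exists (e ^+ 2 / 2); first by rewrite divr_gt0// exprn_gt0.
move=> x; have := nrm_ge0 x; rewrite le_eqVlt => /orP[/eqP <-|x0].
  by rewrite expr0n/= mulr0 addr_ge0// sqr_ge0.
have h : e * nrm x <= nrm (A x) + nrm (B x).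
  by rewrite leNgt; apply/negP => h; apply: ne; exists x => //; exact: ltW.
have : (e * nrm x) ^+ 2 <= (nrm (A x) + nrm (B x)) ^+ 2.
  rewrite ler_pXn2r ?nnegrE//; first by rewrite mulr_ge0// ltW.
  by rewrite addr_ge0// nrm_ge0.
by have := sqr_ge0 (nrm (A x) - nrm (B x)); rewrite exprMn; lra.
Qed.

Lemma taylor_spectrum_bGamma (R : realType) (H : hilbertSpace R) (S S' P P' : H -> H) (MP : R) :
  adjoint_pair S S' -> adjoint_pair P P' -> 0 <= MP -> norm_bound P MP ->
  (forall x, S (S' x) = S' (S x)) -> (forall x, P (P' x) = P' (P x)) ->
  (forall x, S (P x) = P (S x)) -> (forall x, P' (P x) = x) ->
  (forall x, S x = S' (P x)) -> (forall x, nrm (S x) <= 2 * nrm x) ->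
  taylor_spectrum S P `<=` bGamma.
Proof.
move=> hS hP MP0 bP nS nP cSP uP SP bS [s p] /= nex; apply: contrapT => nb; apply: nex.
have lS := adjoint_pair_linear (adjoint_pairC hS).
have lP := adjoint_pair_linear (adjoint_pairC hP).
have lS' := adjoint_pair_linear hS; have lP' := adjoint_pair_linear hP.
have cSP' := commute_adjoint_right nP cSP uP.
have cPS' := commute_adjoint_left hS hP nP cSP uP.
have iP x : nrm (P x) = nrm x.
  by apply/eqP; rewrite -(@eqrXn2 _ 2) ?nrm_ge0// !nrm_sqr hP uP.
have [|c c0 hc] := @coercive_of_nondegenerate R H (fun x => S x - s *: x) (fun x => P x - p *: x).
  move=> /(degenerate_equations hS nS iP SP bS)[p1 sE s2]; apply: nb.
  apply: bGamma_of_equations => //; first by rewrite cabsE p1.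
  by rewrite cabsE -(rmorph_nat (real_complex R) 2) lecR.
have bnd (T : H -> H) a M : norm_bound T M -> norm_bound (fun x => T x - a *: x) (M + cabs a).
  by move=> bT x; apply: le_trans (nrmB _ _) _; rewrite nrmZ mulrDl lerD2r.
pose M := (2 + cabs s) + (MP + cabs p).
have s0 := cabs_ge0 s; have p0 := cabs_ge0 p.
apply: (@coercive_koszul_exact R H (fun x => S x - s *: x) (fun x => S' x - conjc s *: x)
  (fun x => P x - p *: x) (fun x => P' x - conjc p *: x) M c) => //.
- exact: adjoint_pair_shift.
- exact: adjoint_pair_shift.
- by rewrite /M; lra.
- move=> x; apply: le_trans (bnd S s 2 bS x) _.
  by rewrite ler_wpM2r ?nrm_ge0// /M lerDl addr_ge0.
- move=> x; apply: le_trans (bnd P p MP bP x) _.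
  by rewrite ler_wpM2r ?nrm_ge0// /M lerDr addr_ge0.
- exact: commute_shift.
- exact: commute_shift.
- exact: commute_shift.
- exact: commute_shift.
- exact: commute_shift.
Qed.

Theorem theorem5p4 (R : realType) (H : hilbertSpace R) (S P : H -> H)
    (bS : bounded_operator S) (bP : bounded_operator P)
    (cSP : S \o P = P \o S) :
  Gamma_unitary S P <->
  [/\ normal_operator P,
      S = adjoint S \o P &
      sqrt_operator (adjoint ((S \o S) - 4 *: P) \o ((S \o S) - 4 *: P))
        + (adjoint S \o S) = 4 *: idfun].
Proof.
have hS := adjointP bS; have hP := adjointP bP.
set S' := adjoint S in hS *; set P' := adjoint P in hP *.
have lS' := adjoint_pair_linear hS; have lP' := adjoint_pair_linear hP.
have [lS [MS MS0 nbS]] := bounded_operatorP bS.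
have [lP [MP MP0 nbP]] := bounded_operatorP bP.
have cSPx x : S (P x) = P (S x) := congr1 (@^~ x) cSP.
have cSPx' := adjoint_commute hS hP cSPx.
have conj4 : conjc (4 : R[i]) = 4 by exact: conjc_nat.
have QE : adjoint ((S \o S) - 4 *: P) = (fun x => S' (S' x) - 4 *: P' x).
  apply: adjoint_unique => x y; rewrite ipBr ipZr conj4 -!hS -hP.
  by rewrite [LHS](ipBl (S (S x)) (4 *: P x)) ipZl.
rewrite QE; set Q := (X in sqrt_operator X).
have QEx x : Q x = S' (S' (S (S x) - 4 *: P x)) - 4 *: P' (S (S x) - 4 *: P x) by [].
(* [P' (P x)] is left in place: in the forward direction it is already [x], in the converse it is
   the unknown. *)
have QE2 x : (forall x, S (S' x) = S' (S x)) -> (forall x, S x = S' (P x)) ->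
    (forall x, S' x = P' (S x)) ->
    Q x = S' (S (S' (S x))) - 8 *: S' (S x) + 16 *: P' (P x).
  move=> nS SP S'P; rewrite QEx (linearopB _ _ lS') (linearopB _ _ lS') (linearopB _ _ lP').
  rewrite !(linearopZ _ _ lS') (linearopZ _ _ lP') -SP -S'P -nS scalerBr opprB scalerA.
  rewrite -natrM addrA addrAC; congr (_ + _); rewrite -addrA -opprD -scalerDl -natrD.
  by rewrite !nS.
have sqE x : 4 *: (4 *: x - S' (S x)) - S' (S (4 *: x - S' (S x))) =
    S' (S (S' (S x))) - 8 *: S' (S x) + 16 *: x.
  rewrite (linearopB _ _ lS) (linearopB _ _ lS') (linearopZ _ _ lS) (linearopZ _ _ lS').
  rewrite scalerBr opprB scalerA -natrM [RHS]addrC -addrA; congr (_ + _).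
  by rewrite addrCA -opprD -scalerDl -natrD.
have T0p : (forall x, nrm (S x) <= 2 * nrm x) ->
    positive_operator (fun x => 4 *: x - S' (S x)).
  move=> S2; split.
    apply: (@bounded_operatorI _ _ _ (4 + MS * MS)).
      move=> a x y; rewrite lS lS' scalerDr opprD addrACA scalerBr; congr (_ - _ + _).
      by rewrite !scalerA mulrC.
    move=> x; apply: le_trans (nrmB _ _) _; rewrite nrmZ mulrDl.
    have -> : cabs (4 : R[i]) = 4 by rewrite -(rmorph_nat (real_complex R) 4) cabs_real ger0_norm.
    rewrite lerD2l; apply: le_trans (adjoint_pair_bound MS0 hS nbS _) _.
    by rewrite -mulrA ler_wpM2l.
  move=> x; rewrite -/(ip _ _) ipBl ipZl (adjoint_pairC hS) !ipxx.
  rewrite -(rmorph_nat (real_complex R) 4) -realCM -rmorphB /= ler0c subr_ge0.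
  have -> : 4 * nrm x ^+ 2 = (2 * nrm x) ^+ 2 by ring.
  by rewrite ler_pXn2r ?nnegrE ?nrm_ge0// mulr_ge0// nrm_ge0.
split.
- move=> [_ nSo nPo spec].
  have nS x : S (S' x) = S' (S x) := congr1 (@^~ x) nSo.
  have nP x : P (P' x) = P' (P x) := congr1 (@^~ x) nPo.
  have hsp s p : taylor_spectrum S P (s, p) -> [/\ cabs p = 1, s = conjc s * p & cabs s <= 2].
    by move=> /spec /bGamma_equations.
  have uP : forall x, P' (P x) = x.
    by apply: (isometry_of_spectrum hS hP MS0 nbS MP0 nbP nS nP cSPx) => s p /hsp[].
  have SP : forall x, S x = S' (P x).
    by apply: (relation_of_spectrum hS hP MS0 nbS MP0 nbP nS nP cSPx uP) => s p /hsp[].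
  have S2 : forall x, nrm (S x) <= 2 * nrm x.
    by apply: (norm_of_spectrum hS hP MS0 nbS MP0 nbP nS nP cSPx uP) => s p /hsp[].
  have S'P x : S' x = P' (S x).
    by apply: eq_of_ip => z; rewrite -hS SP -hP -(adjoint_pairC hS).
  split=> //; first by apply/funext => x; exact: SP.
  have T0T0 : (fun x => 4 *: x - S' (S x)) \o (fun x => 4 *: x - S' (S x)) = Q.
    by apply/funext => x; rewrite QE2// uP -sqE.
  have sq : sqrt_operator Q = (fun x => 4 *: x - S' (S x)).
    apply: xget_unique; first by split; [exact: T0p|].
    move=> T [pT TT]; apply: sqrt_unique => //; first exact: T0p.
    by move=> x; have := congr1 (@^~ x) TT; rewrite -T0T0.
  by apply/funext => x; rewrite sq; exact: subrK.
- move=> [nPo SPo eq].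
  have nP x : P (P' x) = P' (P x) := congr1 (@^~ x) nPo.
  have SP x : S x = S' (P x) := congr1 (@^~ x) SPo.
  have S'P x : S' x = P' (S x).
    by apply: eq_of_ip => z; rewrite -hS SP -hP -(adjoint_pairC hS).
  have SP' x : S (P' x) = P' (S x).
    by rewrite SP nP cSPx' -SP.
  have nS x : S (S' x) = S' (S x) by rewrite [S' x]S'P SP' -S'P.
  have eqx x : sqrt_operator Q x + S' (S x) = 4 *: x := congr1 (@^~ x) eq.
  have S2_of x : Re (ip (S' (S x)) x) <= 4 * nrm x ^+ 2 -> nrm (S x) <= 2 * nrm x.
    rewrite (adjoint_pairC hS) -nrm_sqr => h.
    rewrite -(@ler_pXn2r _ 2) ?nnegrE ?nrm_ge0 ?mulr_ge0 ?nrm_ge0//.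
    by rewrite exprMn -natrX.
  have Re4 (x : H) : Re (ip (4 *: x) x) = 4 * nrm x ^+ 2.
    transitivity (Re ((4 : R)%:C * ip x x)); last by rewrite ipxx -realCM.
    by rewrite ipZl (rmorph_nat (real_complex R) 4).
  have [S2 uP] : (forall x, nrm (S x) <= 2 * nrm x) /\ forall x, P' (P x) = x.
    have [ex|nex] := pselect (exists T, positive_operator T /\ T \o T = Q).
      have [pT TT] := xgetPex (0 : H -> H) ex; rewrite -/(sqrt_operator Q) in pT TT.
      have TE x : sqrt_operator Q x = 4 *: x - S' (S x) by rewrite -eqx addrK.
      split=> x.
        apply: S2_of; have := positive_Re x pT; rewrite TE ipBl raddfB/= Re4; lra.
      (* The third equation identifies the root as [4 - S'S]. Comparing its square with [QE2]
         cancels all terms but [16 P' (P x) = 16 x]. *)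
      have := congr1 (@^~ x) TT; rewrite /= QE2// !TE sqE => /addrI h.
      by apply: (scalerI _ (esym h)); rewrite pnatr_eq0.
    (* [sqrt_operator] then has its default value 0, and the third equation still
       gives [S*S = 4], [S ^ 2 = 4 P] and [P*P = 1]. *)
    have T0 : sqrt_operator Q = 0.
      by apply: xgetPN => T hT; apply: nex; exists T.
    have SS x : S' (S x) = 4 *: x by rewrite -eqx T0 add0r.
    split=> x; first by apply: S2_of; rewrite SS Re4.
    have := SS x; rewrite S'P (SP x) nS SS (linearopZ _ _ lP') => h.
    by apply: (scalerI _ h); rewrite pnatr_eq0.
  split=> //; first by apply/funext => x; exact: nS.
  exact: (taylor_spectrum_bGamma hS hP MP0 nbP nS nP cSPx uP SP S2).
Qed.
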